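(* Let $k\ge 0$ be an integer and $h>0$. The generalized eigenvalue problem $$(\mathcal K^h(\xi)-\sigma(\xi)\bm M^h)\,\bm v(\xi)=\bm 0,\qquad \bm v(\xi)\in\mathbb C^{k+1}\setminus\{\bm 0\},\qquad \xi\in\Pi_h=[-\tfrac{\pi}{h},\tfrac{\pi}{h}],$$ admits $k+1$ real-analytic (in $\xi$) eigenpairs $\{\sigma_j(\xi),\bm v_j(\xi)\}_{j=1}^{k+1}$ forming an $\bm M^h$-orthonormal basis, i.e. $\bm v_i(\xi)^H\bm M^h\bm v_j(\xi)=\delta_{ij}$, with the following properties. (1) There is a unique principal branch, denoted $(\sigma_{ph}(\xi),\bm v_{ph}(\xi))$, satisfying $$\sigma_{ph}(0)=0,\qquad \bm v_{ph}(0)\propto \bm e_0=(1,0,\dots,0)^T,\qquad \sigma_{ph}''(0)=2,$$ while the remaining $k$ branches, denoted $(\sigma_{sp,i}(\xi),\bm v_{sp,i}(\xi))$, satisfy $\sigma_{sp,i}(0)>0$ for $i=1,\dots,k$. (2) The eigenvalues satisfy $\sigma_{ph}(\xi)=\sigma_{ph}(-\xi)$ and $\sigma_{sp,i}(\xi)=\sigma_{sp,i}(-\xi)$, $i=1,\dots,k$.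
   Context: Mesh: $h>0$, $x_j=jh$, $x_{j+1/2}=(j+\tfrac12)h$, $I_j=(x_{j-1/2},x_{j+1/2})$, $j\in\mathbb Z$. $V_h^k=\{v\in L^2(\mathbb R): v|_{I_j}\in P^k(I_j)\ \forall j\}$, with $P^k(I_j)$ the polynomials of degree at most $k$. On $I_j$ a function $u_h\in V_h^k$ is written in the monomial basis $\phi_{j,l}(x)=\big(\tfrac{x-x_j}{h/2}\big)^l$, $l=0,\dots,k$, with coefficient vector $\bm u_j\in\mathbb C^{k+1}$. Superscripts $\pm$ denote right/left limits at interfaces. Local LDG matrices (alternating fluxes $\widetilde u_h=u_h^-$, $\widetilde q_h=q_h^+$): given $u_h$, the auxiliary variable $q_h\in V_h^k$ is defined by $$\int_{I_j} q_h v\,dx=-\int_{I_j}u_hv_x\,dx+(u_h)^-_{j+1/2}v^-_{j+1/2}-(u_h)^-_{j-1/2}v^+_{j-1/2}\qquad\forall v\in P^k(I_j),\ j\in\mathbb Z.$$ The mass matrix is $\bm M^h=\big(\int_{I_j}\phi_{j,l}\phi_{j,m}\,dx\big)_{l,m=0}^k$, and the real $(k+1)\times(k+1)$ stiffness blocks $\bm K^h_{-1},\bm K^h_0,\bm K^h_{+1}$ are defined by $$\big(\bm K^h_{-1}\bm u_{j-1}+\bm K^h_0\bm u_j+\bm K^h_{+1}\bm u_{j+1}\big)_l=\int_{I_j}q_h(\phi_{j,l})_x\,dx-(q_h)^+_{j+1/2}(\phi_{j,l})^-_{j+1/2}+(q_h)^+_{j-1/2}(\phi_{j,l})^+_{j-1/2},\quad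 l=0,\dots,k.$$ The symbol matrix is $\mathcal K^h(\xi)=\bm K^h_0+\bm K^h_{-1}e^{-\sqrt{-1}\,\xi h}+\bm K^h_{+1}e^{\sqrt{-1}\,\xi h}$. $H$ denotes conjugate transpose. *)

(* Defs.v *)
From HB Require Import structures.
From mathcomp Require Import all_boot all_order all_algebra.
From mathcomp Require Import sesquilinear spectral.
From mathcomp Require Import all_classical all_reals all_analysis.
From mathcomp Require Import complex.

Set Implicit Arguments.
Unset Strict Implicit.
Unset Printing Implicit Defensive.

Import Order.TTheory GRing.Theory Num.Theory.
Import numFieldNormedType.Exports.

Local Open Scope classical_set_scope.
Local Open Scope ring_scope.
Local Open Scope complex_scope.
Local Open Scope sesquilinear_scope.

(* Limits and integrals of complex-valued functions of a real variable are
   taken componentwise. *)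
Section ComplexValued.
Variable R : realType.
Implicit Types (f : R -> R[i]) (D : set R) (x : R).

Definition limC (F : set_system R) f : R[i] :=
  lim (complex.Re (f t) @[t --> F]) +i* lim (complex.Im (f t) @[t --> F]).

Definition trace_left f x : R[i] := limC x^'- f.

Definition trace_right f x : R[i] := limC x^'+ f.

Definition intC D f : R[i] :=
  (\int[lebesgue_measure]_(x in D) complex.Re (f x))%R
  +i* (\int[lebesgue_measure]_(x in D) complex.Im (f x))%R.

Definition L2 f : Prop :=
  (fun x => complex.Re (f x)) \in Lfun lebesgue_measure 2%:E /\
  (fun x => complex.Im (f x)) \in Lfun lebesgue_measure 2%:E.

Definition expi (t : R) : R[i] := cos t +i* sin t.

Definition real_analytic_at (g : R -> R) x : Prop :=
  exists (a : nat -> R) (r : R), 0 < r /\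
    forall t, `|t - x| < r -> pseries a (t - x) @ \oo --> g t.

Definition real_analytic_atC f x : Prop :=
  real_analytic_at (fun t => complex.Re (f t)) x /\
  real_analytic_at (fun t => complex.Im (f t)) x.

End ComplexValued.

Section LDG.
Variable R : realType.
Variable h : R.
Variable k : nat.
Implicit Types (j : int) (u q : R -> R[i]).

Definition node j : R := j%:~R * h.
Definition node_l j : R := (j%:~R - 2^-1) * h.
Definition node_r j : R := (j%:~R + 2^-1) * h.

Definition cell j : set R := [set x | node_l j < x < node_r j].

Definition Pk : set {poly R[i]} := [set v | (size v <= k.+1)%N].

(* Elements of V_h^k are represented by actual functions, whose values at the
   interfaces (a null set) are irrelevant. *)
Definition Vh u : Prop :=
  L2 u /\
  forall j, exists2 v, Pk v & forall x, cell j x -> u x = v.[x%:C].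

Definition phi j (l : nat) : {poly R} :=
  ((h / 2)^-1 *: ('X - (node j)%:P)) ^+ l.

Definition phiC j (l : nat) : {poly R[i]} := map_poly (real_complex R) (phi j l).

Definition coefficients u (c : int -> 'cV[R[i]]_k.+1) : Prop :=
  forall j x, cell j x -> u x = \sum_(l < k.+1) c j l 0 * (phiC j l).[x%:C].

(* The polynomials v and phi_{j,l} are smooth on the whole line, so that their
   traces at the endpoints of a cell are their values there. *)
Definition ldg_auxiliary u q : Prop :=
  forall j v, Pk v ->
    intC (cell j) (fun x => q x * v.[x%:C]) =
    - intC (cell j) (fun x => u x * v^`().[x%:C])
    + trace_left u (node_r j) * v.[(node_r j)%:C]
    - trace_left u (node_l j) * v.[(node_l j)%:C].

Definition ldg_residual q j (l : nat) : R[i] :=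
  intC (cell j) (fun x => q x * (phiC j l)^`().[x%:C])
  - trace_right q (node_r j) * (phiC j l).[(node_r j)%:C]
  + trace_right q (node_l j) * (phiC j l).[(node_l j)%:C].

(* The integrals do not depend on the cell: they are computed on I_0. *)
Definition mass_mx : 'M[R]_k.+1 :=
  \matrix_(l, m)
    (\int[lebesgue_measure]_(x in cell 0) ((phi 0 l).[x] * (phi 0 m).[x]))%R.

(* Real matrices; this determines them uniquely. *)
Definition stiffness_blocks (Km K0 Kp : 'M[R]_k.+1) : Prop :=
  forall u q c, Vh u -> Vh q -> ldg_auxiliary u q -> coefficients u c ->
  forall j (l : 'I_k.+1),
    (map_mx (real_complex R) Km *m c (j - 1)
     + map_mx (real_complex R) K0 *m c j
     + map_mx (real_complex R) Kp *m c (j + 1)) l 0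
    = ldg_residual q j l.

Definition massC : 'M[R[i]]_k.+1 := map_mx (real_complex R) mass_mx.

Definition symbol_mx (Km K0 Kp : 'M[R]_k.+1) (xi : R) : 'M[R[i]]_k.+1 :=
  map_mx (real_complex R) K0
  + expi (- (xi * h)) *: map_mx (real_complex R) Km
  + expi (xi * h) *: map_mx (real_complex R) Kp.

Definition Pi_h : set R := [set xi | - (pi / h) <= xi <= pi / h].

Definition gen_eigenpair (A B : 'M[R[i]]_k.+1) (s : R) (v : 'cV[R[i]]_k.+1) :=
  v != 0 /\ (A - s%:C *: B) *m v = 0.

Definition e0 : 'cV[R[i]]_k.+1 := delta_mx 0 0.

Definition principal (sigma : R -> R) (v : R -> 'cV[R[i]]_k.+1) : Prop :=
  [/\ sigma 0 = 0,
      exists2 c : R[i], c != 0 & v 0 = c *: e0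
    & derive1n 2 sigma 0 = 2].

End LDG.

(* Main.v *)
Require Import Defs.
From HB Require Import structures.
From mathcomp Require Import all_boot all_order all_algebra.
From mathcomp Require Import sesquilinear spectral.
From mathcomp Require Import all_classical all_reals all_analysis.
From mathcomp Require Import complex.
From mathcomp Require Import ring lra.

Set Implicit Arguments.
Unset Strict Implicit.
Unset Printing Implicit Defensive.

Import Order.TTheory GRing.Theory Num.Theory.
Import numFieldNormedType.Exports.

Local Open Scope classical_set_scope.
Local Open Scope ring_scope.
Local Open Scope complex_scope.
Local Open Scope sesquilinear_scope.

(** Write [z] for the phase factor [exp (- i xi h)]. Testing the definition of the
    blocks with a function supported on one cell shows that the symbol matrix is
    [D(z)^H M^-1 D(z)], where [D(z)] is the weak derivative of a Bloch wave, with
    the trace [z v(right)] entering from the preceding cell ([symbol_mxE]). In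
    strong form, with the auxiliary variable [q] of the wave [v], the eigenvalue
    problem is the pair of equations [q = v' + [v] delta_l] and
    [s v + q' = [q] delta_r], where [[v]] and [[q]] are jumps and [delta_l],
    [delta_r] represent the evaluations at the ends of a cell ([bloch_pair]).

    Every eigenvalue is simple, for every phase ([bloch_simple]). Pairing the
    first equation with [v] and the second one with [q] gives
    [s |[v]|^2 = |[q]|^2]. If [s] is nonzero and [[v] = 0], then [[q] = 0] as well,
    and [v'' = - s v] forces the polynomial [v] to vanish; hence the jump is
    injective on each eigenspace. If [s = 0], then [q = 0] and [v] is constant, which
    requires [z = 1]. So the eigenvalues never cross, and numbering them by size
    gives branches that are analytic by the analytic implicit function theorem
    for simple roots of the characteristic polynomial
    ([simple_hermitian_family]). Complex conjugation exchanges [z] with its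
    conjugate and preserves the eigenvalues, so every branch is even. At [xi = 0]
    the eigenvalue 0 is simple with constant eigenvectors, and the other
    eigenvalues are positive.

    Global analytic eigenvectors are obtained from a linear functional that
    vanishes at no eigenvector of the branch ([analytic_kernel]). On a branch with
    positive eigenvalues the jump is such a functional. On the lowest branch the
    jump vanishes at [xi = 0], and the trace at the right end of the cell is used
    ([lowest_band_trace]): reflection combined with complex conjugation maps [q]
    to another eigenvector for the same [s], so if [v] vanishes at the right
    end then [q] vanishes at the left end, the phase drops out of both equations,
    and [s] is an eigenvalue for all phases. The lowest branch would then be
    constantly [s] by connectedness, so that [s = 0]; but then [v] is a nonzero
    constant, whose trace does not vanish.

    The same symmetry gives [s |mean v|^2 = |1 - z|^2 |v(right)|^2]
    ([bloch_mean]). On the lowest branch, at 0, the mean is [h] times the trace,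
    and [|1 - z|^2 = 2 - 2 cos (xi h)]; so the second derivative is 2.

    The theory of real-analytic functions is developed on truncated power
    series, that is on polynomials, with the norm [pnorm]. The implicit function
    is the limit of truncated Picard iterates, whose norms stay bounded on a small
    disc ([fixpoint_analytic]). *)

(** * Power series as limits of polynomials *)

Section PolyNorm.
Variable R : realType.
Implicit Types (p q : {poly R}) (a b : nat -> R) (r x t : R).

Definition abs_poly p : {poly R} := \poly_(i < size p) `|p`_i|.

(** The weighted sum of the moduli of the coefficients is submultiplicative. All
    operations on power series below are carried out on their truncations, with
    errors controlled by this norm, so that no double series is rearranged. *)
Definition pnorm r p : R := (abs_poly p).[r].

Lemma coef_abs_poly p i : (abs_poly p)`_i = `|p`_i|.
Proof.
by rewrite coef_poly; case: ltnP => // /leq_sizeP/(_ _ (leqnn i)) ->; rewrite normr0.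
Qed.

Lemma pnormE r p n : (size p <= n)%N -> pnorm r p = \sum_(i < n) `|p`_i| * r ^+ i.
Proof.
move=> pn; rewrite /pnorm (@horner_coef_wide _ n) ?(leq_trans (size_poly _ _))//.
by apply: eq_bigr => i _; rewrite coef_abs_poly.
Qed.

Lemma pnorm_le r p q : 0 <= r -> (forall i, `|p`_i| <= q`_i) -> pnorm r p <= q.[r].
Proof.
move=> r0 pq; pose n := maxn (size p) (size q).
rewrite (@pnormE _ _ n) ?leq_maxl// (@horner_coef_wide _ n) ?leq_maxr//.
by apply: ler_sum => i _; rewrite ler_wpM2r// exprn_ge0.
Qed.

Lemma pnorm_ge0 r p : 0 <= r -> 0 <= pnorm r p.
Proof.
move=> r0; rewrite (pnormE _ (leqnn _)); apply: sumr_ge0 => i _.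
by rewrite mulr_ge0 ?exprn_ge0.
Qed.

Lemma pnormD r p q : 0 <= r -> pnorm r (p + q) <= pnorm r p + pnorm r q.
Proof.
move=> r0; rewrite -hornerD; apply: pnorm_le => // i.
by rewrite !coefD !coef_abs_poly ler_normD.
Qed.

Lemma pnormM r p q : 0 <= r -> pnorm r (p * q) <= pnorm r p * pnorm r q.
Proof.
move=> r0; rewrite -hornerM; apply: pnorm_le => // i.
rewrite !coefM (le_trans (ler_norm_sum _ _ _))//; apply: ler_sum => j _.
by rewrite !coef_abs_poly normrM.
Qed.

Lemma pnorm_sum r n (F : 'I_n -> {poly R}) : 0 <= r ->
  pnorm r (\sum_i F i) <= \sum_i pnorm r (F i).
Proof.
move=> r0; elim/big_rec2 : _ => [|i y1 y2 _ IH].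
  by rewrite (@pnormE _ _ 0) ?size_poly0// big_ord0.
by rewrite (le_trans (pnormD _ _ r0))// lerD2l.
Qed.

Lemma pnormX r p n : 0 <= r -> pnorm r (p ^+ n) <= pnorm r p ^+ n.
Proof.
move=> r0; elim: n => [|n IH].
  rewrite !expr0 (@pnormE _ _ 1) ?size_poly1//.
  by rewrite big_ord1 coef1 eqxx normr1 expr0 mulr1.
by rewrite !exprS (le_trans (pnormM _ _ r0))// ler_wpM2l ?pnorm_ge0.
Qed.

Lemma pnorm_take r p n : 0 <= r -> pnorm r (take_poly n p) <= pnorm r p.
Proof.
move=> r0; apply: pnorm_le => // i; rewrite coef_abs_poly coef_take_poly.
by case: ifP => // _; rewrite normr0.
Qed.

(** A polynomial without terms of degree below [N] is small near the origin;
    this bounds every truncation error below. *)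
Lemma horner_high r p N t : 0 < r -> `|t| <= r -> (forall i, (i < N)%N -> p`_i = 0) ->
  `|p.[t]| <= (`|t| / r) ^+ N * pnorm r p.
Proof.
move=> r0 tr p0; rewrite (pnormE _ (leqnn _)) horner_coef mulr_sumr.
rewrite (le_trans (ler_norm_sum _ _ _))//; apply: ler_sum => i _.
have [iN|Ni] := ltnP i N; first by rewrite p0// !(mul0r, normr0, mulr0).
rewrite normrM normrX mulrCA ler_wpM2l//.
have -> : `|t| ^+ i = (`|t| / r) ^+ i * r ^+ i by rewrite -exprMn divfK// gt_eqF.
rewrite ler_wpM2r ?exprn_ge0 ?(ltW r0)//.
by rewrite ler_wiXn2l ?divr_ge0 ?(ltW r0)// ler_pdivrMr ?mul1r.
Qed.

Definition trunc a n : {poly R} := \poly_(i < n) a i.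

Lemma pnorm_trunc r a n : pnorm r (trunc a n) = \sum_(i < n) `|a i| * r ^+ i.
Proof.
rewrite (@pnormE _ _ n) ?size_poly//; apply: eq_bigr => i _.
by rewrite coef_poly ltn_ord.
Qed.

Lemma trunc_pseries a n x : (trunc a n).[x] = pseries a x n.
Proof. by rewrite horner_poly /pseries /series /= big_mkord. Qed.

(** Besides convergence, the data record a bound on the absolutely convergent
    series at the radius, which makes truncations multiplicative. *)
Definition has_series a r C (g : R -> R) x : Prop :=
  [/\ 0 < r, forall n, pnorm r (trunc a n) <= C
    & forall t, `|t - x| < r -> (trunc a n).[t - x] @[n --> \oo] --> g t].

Lemma pnorm_trunc_cvg a r C t : 0 < r -> (forall n, pnorm r (trunc a n) <= C) ->
  `|t| <= r -> cvgn (fun n => (trunc a n).[t]).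
Proof.
move=> r0 aC tr.
rewrite (_ : (fun n => _) = series (fun i => a i * t ^+ i)); last first.
  by apply/funext => n; rewrite trunc_pseries.
apply: normed_cvg; apply: nondecreasing_is_cvgn.
  exact: (@nondecreasing_series _ (fun i => `|a i * t ^+ i|) xpredT 0).
exists C => _ [n _ <-]; rewrite (le_trans _ (aC n))// pnorm_trunc /normed_series_of /series /= big_mkord.
apply: ler_sum => i _; rewrite normrM ler_wpM2l// normrX lerXn2r// ?qualifE//= ltW//.
Qed.

(** A series that converges at every point of an interval converges absolutely,
    with a bound on the sum, on a smaller one. *)
Lemma real_analyticP g x :
  real_analytic_at g x <-> exists a r C, has_series a r C g x.
Proof.
split=> [[a [r [r0 ag]]]|[a [r [C [r0 aC ag]]]]]; last first.
  exists a, r; split => // t /ag; apply: cvg_trans; apply: near_eq_cvg.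
  by near=> n; rewrite trunc_pseries.
pose s := r / 2; pose w := s / 2.
have s0 : 0 < s by rewrite divr_gt0.
have w0 : 0 < w by rewrite divr_gt0.
have ws : w < s by rewrite /w; lra.
have sr : s < r by rewrite /s; lra.
have cs : cvgn (pseries a s).
  have := ag (x + s); rewrite addrAC subrr add0r gtr0_norm// => /(_ sr) H.
  by apply/cvg_ex; eexists; exact: H.
have cw : cvgn (pseries (fun i => `|a i|) w).
  by apply: (is_cvg_pseries_inside_norm cs); rewrite !gtr0_norm.
exists a, w, (limn (pseries (fun i => `|a i|) w)); split => //.
  move=> n; have -> : pnorm w (trunc a n) = pseries (fun i => `|a i|) w n.
    by rewrite pnorm_trunc /pseries /series/= big_mkord.
  apply: nondecreasing_cvgn_le => //.
  apply: nondecreasing_series => i _ _.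
  by rewrite mulr_ge0// exprn_ge0// ltW.
move=> t tw; have := ag t; have tr: `|t - x| < r by lra.
move=> /(_ tr); apply: cvg_trans; apply: near_eq_cvg.
by near=> n; rewrite trunc_pseries.
Unshelve. all: by end_near.
Qed.

Lemma has_series_shrink a r C g x r' : 0 < r' -> r' <= r ->
  has_series a r C g x -> has_series a r' C g x.
Proof.
move=> r'0 r'r [r0 aC ag]; split => //.
  move=> n; apply: le_trans (aC n); rewrite !pnorm_trunc.
  apply: ler_sum => i _; rewrite ler_wpM2l// lerXn2r// qualifE/= ltW//.
move=> t tr; apply: ag; exact: lt_le_trans tr _.
Qed.

Lemma has_series_x a r C g x : has_series a r C g x -> g x = a 0%N.
Proof.
move=> [r0 _ /(_ x)]; rewrite subrr normr0 => /(_ r0) H.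
have := cvg_lim (@Rhausdorff R) H; move=> <-; apply: lim_near_cst => //; near=> n.
rewrite horner_coef0 coef_poly ifT//; near: n; exact: nbhs_infty_gt.
Unshelve. all: by end_near.
Qed.

(** Polynomials of bounded norm whose terms of low degree vanish tend to zero
    inside the disc, geometrically. *)
Lemma cvg_high_coef (P : nat -> {poly R}) r C t : 0 < r -> `|t| < r ->
  (forall n i, (i < n)%N -> (P n)`_i = 0) -> (forall n, pnorm r (P n) <= C) ->
  (P n).[t] @[n --> \oo] --> (0 : R).
Proof.
move=> r0 tr P0 PC.
apply/norm_cvg0P.
apply: (@squeeze_cvgr _ _ _ _ (cst 0) (fun n => (`|t| / r) ^+ n * C)).
- near=> n; rewrite normr_ge0 /= (le_trans (horner_high r0 (ltW tr) (P0 n)))//.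
  by rewrite ler_wpM2l// exprn_ge0 ?divr_ge0// ltW.
- exact: cvg_cst.
- rewrite -(mul0r C); apply: cvgMr_tmp; apply: cvg_expr.
  by rewrite ger0_norm ?divr_ge0 ?(ltW r0)// ltr_pdivrMr ?mul1r.
Unshelve. all: by end_near.
Qed.

End PolyNorm.
(** * Operations on analytic functions *)
Section AnalyticClosure.
Variable R : realType.
Implicit Types (p q : {poly R}) (a b : nat -> R) (r x t C : R) (f g : R -> R).

Lemma cvg_eq_seq (u v : nat -> R) (l : R) :
  u @ \oo --> l -> (forall n, u n = v n) -> v @ \oo --> l.
Proof. by move=> ul /funext <-. Qed.

Lemma analytic_cst (c : R) x : real_analytic_at (cst c) x.
Proof.
apply/real_analyticP; exists (fun i => if i == 0%N then c else 0), 1, `|c|; split=> //.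
  move=> n; rewrite pnorm_trunc; case: n => [|n]; first by rewrite big_ord0.
  rewrite big_ord_recl /= expr0 mulr1 big1 ?addr0// => i _.
  by rewrite /bump /= normr0 mul0r.
move=> t _; apply: cvg_near_cst; near=> n.
have n0 : (0 < n)%N by near: n; exact: nbhs_infty_gt.
rewrite horner_poly (bigD1 (Ordinal n0))//= mulr1 big1 ?addr0// => i /eqP i0.
case: ifP => [/eqP i00|_]; last by rewrite mul0r.
by case: i0; apply: val_inj.
Unshelve. all: by end_near.
Qed.

Lemma near_eq_analytic f g x : (\forall t \near x, f t = g t) ->
  real_analytic_at f x -> real_analytic_at g x.
Proof.
move=> /nbhs_ballP[e /= e0 fg] [a [r [r0 ar]]]; exists a, (Num.min e r); split.
  by rewrite lt_min e0 r0.
move=> t; rewrite lt_min => /andP[te tr]; rewrite -fg; first exact: ar.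
by rewrite /ball /= distrC.
Qed.

Lemma analyticD f g x : real_analytic_at f x -> real_analytic_at g x ->
  real_analytic_at (fun t => f t + g t) x.
Proof.
move=> [a [r [r0 ar]]] [b [s [s0 bs]]].
exists (fun i => a i + b i), (Num.min r s); split; first by rewrite lt_min r0.
move=> t; rewrite lt_min => /andP[/ar ta /bs tb].
apply: (cvg_eq_seq (cvgD ta tb)) => n.
rewrite fctE /pseries /series /= -big_split /=; apply: eq_bigr => i _.
by rewrite mulrDl.
Qed.

(** Cauchy product: the discarded part of the product of two truncations has no
    term of low degree and a bounded norm. *)
Lemma has_seriesM a b r C C' f g x : has_series a r C f x -> has_series b r C' g x ->
  has_series (fun n => \sum_(i < n.+1) a i * b (n - i)%N) r (C * C')
    (fun t => f t * g t) x.
Proof.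
move=> [r0 aC af] [_ bC' bg].
set c := fun n : nat => _.
have cE n : trunc c n = take_poly n (trunc a n * trunc b n).
  apply/polyP => i; rewrite coef_take_poly coef_poly; case: ltnP => // ni.
  rewrite coefM; apply: eq_bigr => j _; rewrite !coef_poly.
  rewrite (leq_ltn_trans _ ni) ?(leq_ord j)//.
  by rewrite (leq_ltn_trans _ ni) ?leq_subr.
have abC n : pnorm r (trunc a n * trunc b n) <= C * C'.
  rewrite (le_trans (pnormM _ _ (ltW r0)))//.
  by rewrite ler_pM ?pnorm_ge0 ?(ltW r0).
split=> // [n|t tr]; first by rewrite cE (le_trans (pnorm_take _ _ (ltW r0))).
pose P n := trunc a n * trunc b n - trunc c n.
have P0 : (P n).[t - x] @[n --> \oo] --> (0 : R).
  apply: (@cvg_high_coef _ _ r (C * C')) => //.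
    move=> n i ni; rewrite coefB cE coef_take_poly ni subrr //.
  move=> n; apply: le_trans (abC n); rewrite /P cE; apply: pnorm_le; first exact: ltW.
  move=> i; rewrite coef_abs_poly coefB coef_take_poly.
  by case: ifP; rewrite ?subrr ?normr0// subr0.
rewrite -[f t * g t]subr0.
apply: (cvg_eq_seq (cvgB (cvgM (af _ tr) (bg _ tr)) P0)) => n.
by rewrite !fctE /= /P !hornerE; ring.
Qed.

Lemma analyticM f g x : real_analytic_at f x -> real_analytic_at g x ->
  real_analytic_at (fun t => f t * g t) x.
Proof.
move=> /real_analyticP[a [r [C af]]] /real_analyticP[b [s [C' bg]]].
have r0 : 0 < r by case: af.
have s0 : 0 < s by case: bg.
have m0 : 0 < Num.min r s by rewrite lt_min r0.
apply/real_analyticP; do 3 eexists; apply: has_seriesM.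
  by apply: (has_series_shrink m0 _ af); rewrite ge_min lexx.
by apply: (has_series_shrink m0 _ bg); rewrite ge_min lexx orbT.
Qed.

Lemma analyticN f x : real_analytic_at f x -> real_analytic_at (fun t => - f t) x.
Proof.
move=> fx; apply: (near_eq_analytic (f := fun t => cst (-1) t * f t)).
  by near=> t; rewrite /= mulN1r.
by apply: analyticM => //; exact: analytic_cst.
Unshelve. all: by end_near.
Qed.

Lemma analyticB f g x : real_analytic_at f x -> real_analytic_at g x ->
  real_analytic_at (fun t => f t - g t) x.
Proof. by move=> fx gx; apply: analyticD fx (analyticN gx). Qed.

Lemma analytic_sum (I : Type) (s : seq I) (P : pred I) (F : I -> R -> R) x :
  (forall i, real_analytic_at (F i) x) ->
  real_analytic_at (fun t => \sum_(i <- s | P i) F i t) x.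
Proof.
move=> Fx; elim: s => [|i s IH].
  by apply: near_eq_analytic (analytic_cst 0 x); near=> t; rewrite big_nil.
apply: (near_eq_analytic
  (f := fun t => (if P i then F i t else 0) + \sum_(i <- s | P i) F i t)).
  by near=> t; rewrite big_cons; case: ifP; rewrite ?add0r.
apply: analyticD; last exact: IH.
by case: (P i); [exact: Fx|exact: analytic_cst].
Unshelve. all: by end_near.
Qed.

Lemma analyticX f x n : real_analytic_at f x -> real_analytic_at (fun t => f t ^+ n) x.
Proof.
move=> fx; elim: n => [|n IH].
  by apply: near_eq_analytic (analytic_cst 1 x); near=> t; rewrite expr0.
apply: near_eq_analytic (analyticM fx IH).
by near=> t; rewrite exprS.
Unshelve. all: by end_near.
Qed.

Lemma analytic_scale_arg f (c : R) : real_analytic_at f 0 ->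
  real_analytic_at (fun t => f (c * t)) 0.
Proof.
move=> [a [r [r0 ar]]]; exists (fun i => a i * c ^+ i), (r / (1 + `|c|)).
have c0 : 0 < 1 + `|c| by rewrite ltr_pwDl.
split; first by rewrite divr_gt0.
move=> t; rewrite subr0 ltr_pdivlMr// => tr.
have := ar (c * t); rewrite subr0 normrM.
move=> /(_ (le_lt_trans _ tr)); have : `|c| * `|t| <= `|t| * (1 + `|c|).
  by rewrite mulrDr mulr1 mulrC lerDr.
move=> ct /(_ ct) /cvg_eq_seq; apply=> n.
rewrite /pseries /series /=; apply: eq_bigr => i _.
by rewrite exprMn mulrA.
Qed.

Lemma analytic_shift_arg f x : real_analytic_at (fun t => f (t + x)) 0 ->
  real_analytic_at f x.
Proof.
move=> [a [r [r0 ar]]]; exists a, r; split=> // t tr.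
by have := ar (t - x); rewrite subr0 subrK => /(_ tr).
Qed.

Lemma analytic_sin_cos0 : real_analytic_at (@sin R) 0 /\ real_analytic_at (@cos R) 0.
Proof.
split.
  exists (fun n => (odd n)%:R * (-1) ^+ n.-1./2 * n`!%:R^-1), 1; split => // t _.
  rewrite subr0; have /cvg_ex[l H] := @is_cvg_series_sin_coeff R t.
  have -> : sin t = l by rewrite sin.unlock; apply: (cvg_lim (@Rhausdorff R)).
  move: H; rewrite sin_coeffE; exact: cvg_trans.
exists (fun n => (~~ odd n)%:R * (-1) ^+ n./2 * n`!%:R^-1), 1; split => // t _.
rewrite subr0; have /cvg_ex[l H] := @is_cvg_series_cos_coeff R t.
have -> : cos t = l by rewrite cos.unlock; apply: (cvg_lim (@Rhausdorff R)).
move: H; rewrite cos_coeffE; exact: cvg_trans.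
Qed.

(** The addition formulas move the centre of the expansion from 0 to any point. *)
Lemma analytic_cosZ (c : R) x : real_analytic_at (fun t => cos (c * t)) x.
Proof.
have [s0 c0] := analytic_sin_cos0; apply: analytic_shift_arg.
apply: (near_eq_analytic (f := fun t => cos (c * t) * cst (cos (c * x)) t
   - sin (c * t) * cst (sin (c * x)) t)).
  by near=> t; rewrite mulrDr cosD.
apply: analyticB; (apply: analyticM; last exact: analytic_cst);
  exact: (analytic_scale_arg c).
Unshelve. all: by end_near.
Qed.

Lemma analytic_sinZ (c : R) x : real_analytic_at (fun t => sin (c * t)) x.
Proof.
have [s0 c0] := analytic_sin_cos0; apply: analytic_shift_arg.
apply: (near_eq_analytic (f := fun t => sin (c * t) * cst (cos (c * x)) t
   + cos (c * t) * cst (sin (c * x)) t)).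
  by near=> t; rewrite mulrDr sinD.
apply: analyticD; (apply: analyticM; last exact: analytic_cst);
  exact: (analytic_scale_arg c).
Unshelve. all: by end_near.
Qed.

End AnalyticClosure.
(** * The analytic implicit function theorem *)

Section AnalyticFixpoint.
Variable R : realType.
Implicit Types (p q : {poly R}) (a b : nat -> R) (r x t C : R) (f g : R -> R).

Lemma pnorm1 r : pnorm r 1 = 1.
Proof. by rewrite (@pnormE _ _ _ 1) ?size_poly1// big_ord1 coef1 normr1 mulr1. Qed.

Lemma dvdXnP n p : reflect (forall i, (i < n)%N -> p`_i = 0) ('X^n %| p).
Proof.
apply: (iffP idP) => [/dvdpP[q ->] i ni|p0]; first by rewrite coefMXn ni.
rewrite -(poly_take_drop n p); suff -> : take_poly n p = 0 by rewrite add0r dvdp_mull.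
by apply/polyP => i; rewrite coef_take_poly coef0; case: ltnP => // /p0.
Qed.

Lemma cvg_seq_shift N (u : nat -> R) (l : R) :
  u @ \oo --> l -> u (n + N)%N @[n --> \oo] --> l.
Proof. by move=> ul; apply: cvg_comp ul; exact: cvg_addnr. Qed.

Variables (d : nat) (c : nat -> nat -> R).
Hypothesis c00 : c 0%N 0%N = 0.
Hypothesis c10 : c 1%N 0%N = 0.

Let G N p : {poly R} := \sum_(m < d) trunc (c m) N.+2 * p ^+ m.

(** Picard iterates of [y = c_0(t) + c_1(t) y + c_2(t) y^2 + ...]; each step
    determines one more coefficient of the solution. *)
Fixpoint fixpoint_poly N : {poly R} :=
  if N is N'.+1 then take_poly N'.+2 (G N' (fixpoint_poly N')) else 0.

Let Y := fixpoint_poly.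

Let dvdX_trunc m n : c m 0%N = 0 -> 'X %| trunc (c m) n.
Proof.
move=> c0; rewrite -['X]expr1; apply/dvdXnP => -[|//] _.
by rewrite coef_poly c0; case: ifP.
Qed.

Let dvdX_G N p : 'X %| p -> 'X %| G N p.
Proof.
move=> Xp; apply: (big_ind (fun q => 'X %| q)); [exact: dvdp0|exact: dvdp_add|].
move=> [[|m] md] _ /=; first by rewrite expr0 mulr1 dvdX_trunc.
by rewrite exprS dvdp_mull// dvdp_mulr.
Qed.

Let dvdX_Y N : 'X %| Y N.
Proof.
elim: N => [|N IH]; first exact: dvdp0.
rewrite -['X]expr1; apply/dvdXnP => i i1; rewrite /Y /= coef_take_poly.
rewrite (leq_trans i1)//; apply: (dvdXnP 1 _ _) => //.
exact: dvdX_G.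
Qed.

(** Feeding an error of order [n] into the equation returns an error of order
    [n+1]: the linear coefficient and the iterates all vanish at the origin. *)
Let dvdX_subG N n p q : 'X %| p -> 'X %| q -> 'X^n %| p - q ->
  'X^(n.+1) %| G N p - G N q.
Proof.
move=> Xp Xq pq; rewrite -sumrB.
apply: (big_ind (fun q => 'X^(n.+1) %| q)); [exact: dvdp0|exact: dvdp_add|].
move=> [[|[|m]] md] _ /=.
- by rewrite !expr0 subrr dvdp0.
- by rewrite !expr1 -mulrBr exprS dvdp_mul// dvdX_trunc.
- rewrite -mulrBr dvdp_mull// subrXX exprSr dvdp_mul//.
  apply: (big_ind (fun q => 'X %| q)); [exact: dvdp0|exact: dvdp_add|].
  move=> [[|i] im] _; first by rewrite subn0 exprS -mulrA dvdp_mulr.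
  by rewrite dvdp_mull// exprS dvdp_mulr.
Qed.

Let dvdX_G_trunc N p : 'X^(N.+2) %| G N.+1 p - G N p.
Proof.
rewrite -sumrB; apply: (big_ind (fun q => 'X^(N.+2) %| q)); [exact: dvdp0|exact: dvdp_add|].
move=> m _; rewrite -mulrBl dvdp_mulr//; apply/dvdXnP => i iN.
by rewrite coefB !coef_poly iN ltnS (ltnW iN) subrr.
Qed.

Let Y_step N : 'X^(N.+1) %| Y N.+1 - Y N.
Proof.
elim: N => [|N IH].
  by rewrite /= subr0 (dvdX_Y 1).
have H1 := dvdX_subG N.+1 (dvdX_Y N.+1) (dvdX_Y N) IH.
have := dvdp_add H1 (dvdX_G_trunc N (Y N)); rewrite addrA subrK => /dvdXnP H.
apply/dvdXnP => i iN; rewrite coefB {1 2}/Y /= !coef_take_poly iN ltnS (ltnW iN).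
by rewrite -coefB; exact: H.
Qed.

Definition fixpoint_coef i : R := (Y i)`_i.

Let y := fixpoint_coef.

Let Y_coef N i : (i <= N)%N -> (Y N)`_i = y i.
Proof.
move=> /subnK <-; elim: (N - i)%N => // n IH; rewrite -{}IH.
apply/eqP; rewrite addSn -subr_eq0 -coefB; apply/eqP/(dvdXnP _ _ (Y_step _)).
by rewrite ltnS leq_addl.
Qed.

Let Y_trunc N : Y N = trunc y N.+1.
Proof.
apply/polyP => i; rewrite coef_poly ltnS; case: leqP => [/Y_coef//|Ni].
case: N Ni => [|N] Ni; first by rewrite /= coef0.
by rewrite /Y /= coef_take_poly ltnNge Ni.
Qed.

Variables (r C x : R) (g : nat -> R -> R).
Hypothesis r0 : 0 < r.
Hypothesis C1 : 1 <= C.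
Hypothesis cg : forall m, (m < d)%N -> has_series (c m) r C (g m) x.

(** A series without constant term gains the factor [s / r] when its disc
    shrinks from radius [r] to radius [s]. *)
Let pnorm_vanish a s n : a 0%N = 0 -> 0 < s -> s <= r ->
  pnorm s (trunc a n) <= s / r * pnorm r (trunc a n).
Proof.
move=> a0 s0 sr; rewrite !pnorm_trunc mulr_sumr; apply: ler_sum => -[[|i] ni] _ /=.
  by rewrite a0 normr0 !mul0r mulr0.
rewrite mulrCA ler_wpM2l//.
have -> : s ^+ i.+1 = (s / r) ^+ i.+1 * r ^+ i.+1 by rewrite -exprMn divfK// gt_eqF.
rewrite ler_wpM2r ?exprn_ge0 ?(ltW r0)// exprS ler_piMr ?divr_ge0 ?(ltW s0) ?(ltW r0)//.
by rewrite exprn_ile1 ?divr_ge0 ?(ltW s0) ?(ltW r0)// ler_pdivrMr ?mul1r.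
Qed.

(** On a small disc the equation maps a small ball of the summable series into
    itself, so that all the iterates stay there. *)
Let Y_bounded : exists s rho, [/\ 0 < s, s <= r, forall N, pnorm s (Y N) <= rho
  & forall N, pnorm s (G N (Y N)) <= rho].
Proof.
(* With this radius [rho] of the ball each of the [d] terms is at most
   [rho / D]: the terms of degree at least 2 because [rho] is small, the
   other two because they gain the factor [s / r = rho ^+ 2]. *)
pose D : R := d.+1%:R; pose rho := (C * D)^-1.
have D1 : 1 <= D by rewrite ler1n.
have C0 : 0 < C by exact: lt_le_trans C1.
have D0 : 0 < D by rewrite ltr0n.
have CD1 : 1 <= C * D by rewrite -[leLHS]mulr1 ler_pM// ltW.
have rho0 : 0 < rho by rewrite invr_gt0 mulr_gt0.
have rho1 : rho <= 1 by rewrite invf_le1// mulr_gt0.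
have Crho : C * rho = D^-1 by rewrite /rho invfM mulrA divff ?mul1r// gt_eqF.
pose s := r * rho ^+ 2.
have s0 : 0 < s by rewrite mulr_gt0 ?exprn_gt0.
have sr : s <= r by rewrite ler_piMr ?(ltW r0)// exprn_ile1 ?(ltW rho0).
have trb m n : (m < d)%N -> pnorm s (trunc (c m) n) <= C.
  by move=> md; have [_ /(_ n) H _] := has_series_shrink s0 sr (cg md).
have trv m n : (m < d)%N -> c m 0%N = 0 -> pnorm s (trunc (c m) n) <= rho / D.
  move=> md cm0; rewrite (le_trans (pnorm_vanish _ cm0 s0 sr))//.
  have -> : s / r = rho ^+ 2 by rewrite /s mulrAC divff ?mul1r// gt_eqF.
  have [_ /(_ n) H _] := cg md.
  rewrite (le_trans (ler_wpM2l _ H)) ?exprn_ge0 ?(ltW rho0)//.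
  by rewrite expr2 -mulrA [rho * C]mulrC Crho.
have GY N p : pnorm s p <= rho -> pnorm s (G N p) <= rho.
  move=> prho; rewrite (le_trans (pnorm_sum _ (ltW s0)))//.
  have p0 := pnorm_ge0 p (ltW s0).
  rewrite (le_trans (_ : _ <= \sum_(m < d) rho / D)) //; last first.
    rewrite sumr_const card_ord -mulr_natr -mulrA ler_piMr ?(ltW rho0)//.
    by rewrite mulrC ler_pdivrMr// mul1r ler_nat.
  apply: ler_sum => -[[|[|m]] md] _ /=; rewrite (le_trans (pnormM _ _ (ltW s0)))//.
  - by rewrite expr0 pnorm1 mulr1 trv.
  - rewrite expr1 (le_trans (ler_pM _ _ (trv _ _ md c10) (le_trans prho rho1)))//.
      exact: pnorm_ge0 (ltW s0).
    by rewrite mulr1.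
  - rewrite (le_trans (ler_pM _ _ (trb _ _ md) (pnormX _ _ (ltW s0))))//.
    + exact: pnorm_ge0 (ltW s0).
    + exact: pnorm_ge0 (ltW s0).
    rewrite -Crho (mulrCA rho) ler_wpM2l ?(ltW C0)// -addn2 exprD expr2.
    have p1 : pnorm s p ^+ m <= 1 by rewrite exprn_ile1// (le_trans prho).
    by rewrite -[leRHS]mul1r ler_pM ?mulr_ge0 ?exprn_ge0// ler_pM.
have Yb N : pnorm s (Y N) <= rho.
  elim: N => [|N IH] /=.
    by rewrite (@pnormE _ _ _ 0) ?size_poly0// big_ord0 ltW.
  by rewrite (le_trans (pnorm_take _ _ (ltW s0)))// GY.
by exists s, rho; split=> // N; exact: GY.
Qed.

(** The limit of the iterates solves the equation because each iterate solves it
    up to terms of high degree. *)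
Lemma fixpoint_analytic : exists f, [/\ real_analytic_at f x, f x = 0 &
  \forall t \near x, f t = \sum_(m < d) g m t * f t ^+ m].
Proof.
have [s [rho [s0 sr Yrho Grho]]] := Y_bounded.
have yrho n : pnorm s (trunc y n) <= rho.
  case: n => [|n]; last by rewrite -Y_trunc.
  rewrite (le_trans _ (Yrho 0%N))//= (@pnormE _ _ _ 0) ?size_poly//.
  by rewrite big_ord0 pnorm_ge0 ?(ltW s0).
pose f t := limn (fun n => (trunc y n).[t - x]).
have yf : has_series y s rho f x.
  split=> // t ts; exact: (pnorm_trunc_cvg s0 yrho (ltW ts)).
exists f; split.
- by apply/real_analyticP; exists y, s, rho.
- by rewrite (has_series_x yf) /y /fixpoint_coef coef0.
apply/nbhs_ballP; exists s => //= t; rewrite /ball /= distrC => ts.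
have [_ _ /(_ t ts) yt] := yf.
pose E N := G N (Y N) - trunc y N.+2.
have EE N : E N = G N (Y N) - take_poly N.+2 (G N (Y N)) by rewrite /E -Y_trunc.
have E0 : (E n).[t - x] @[n --> \oo] --> (0 : R).
  apply: (cvg_high_coef s0 ts (C := rho)) => n.
    by move=> i ni; rewrite EE coefB coef_take_poly leqW ?leqW// subrr.
  apply: le_trans (Grho n); rewrite EE; apply: pnorm_le; first exact: ltW.
  move=> i; rewrite coef_abs_poly coefB coef_take_poly.
  by case: ifP; rewrite ?subrr ?normr0// subr0.
have Gf : (G n (Y n)).[t - x] @[n --> \oo] --> \sum_(m < d) g m t * f t ^+ m.
  apply: (@cvg_eq_seq _ (fun n =>
      \sum_(m < d) (trunc (c m) n.+2).[t - x] * (trunc y n.+1).[t - x] ^+ m)).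
    apply: cvg_big => //; first by move=> ? ?; exact: add_continuous.
    move=> m _; apply: cvgM.
      have [_ _ /(_ t (lt_le_trans ts sr)) H] := cg (ltn_ord m).
      by apply: (cvg_eq_seq (cvg_seq_shift 2 H)) => n; rewrite addn2.
    elim: (m : nat) => [|i IH]; first exact: cvg_cst.
    rewrite exprS; apply: (cvg_eq_seq (cvgM (cvg_seq_shift 1 yt) IH)) => n.
    by rewrite /= addn1 exprS.
  move=> n; rewrite horner_sum; apply: eq_bigr => m _.
  by rewrite hornerM horner_exp Y_trunc.
apply: (cvg_unique (@Rhausdorff R) (cvg_seq_shift 2 yt)) => /=.
rewrite -[X in _ --> X]subr0; apply: (cvg_eq_seq (cvgB Gf E0)) => n.
by rewrite !fctE /E addn2 hornerD hornerN opprB addrC subrK.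
Qed.

End AnalyticFixpoint.
Section AnalyticRoots.
Variable R : realType.
Implicit Types (p q : {poly R}) (a b : nat -> R) (r x t C : R) (f g : R -> R).

Lemma common_series (g : nat -> R -> R) x d : (forall m, real_analytic_at (g m) x) ->
  exists c r C, [/\ 0 < r, 1 <= C & forall m, (m < d)%N -> has_series (c m) r C (g m) x].
Proof.
move=> gx; elim: d => [|d [c [r [C [r0 C1 cg]]]]].
  by exists (fun _ _ => 0), 1, 1.
have /real_analyticP[a [s [C' ag]]] := gx d.
have s0 : 0 < s by case: ag.
have m0 : 0 < Num.min r s by rewrite lt_min r0.
exists (fun m => if m == d then a else c m), (Num.min r s), (Num.max C C').
split=> //; first by rewrite le_max C1.
have weaken b D (w : R) (u : R -> R) : has_series b w D u x -> D <= Num.max C C' ->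
    Num.min r s <= w -> has_series b (Num.min r s) (Num.max C C') u x.
  move=> bD DC /(has_series_shrink m0)/(_ bD)[? bs ?].
  by split=> // n; apply: le_trans (bs n) DC.
move=> m; rewrite ltnS leq_eqVlt; case: eqVneq => [-> _|_ /= md].
  by apply: (weaken _ _ _ _ ag); rewrite ?le_max ?lexx ?orbT// ge_min lexx orbT.
by apply: (weaken _ _ _ _ (cg _ md)); rewrite ?le_max ?lexx// ge_min lexx.
Qed.

(** Translating the root to the origin and dividing by the nonzero derivative
    puts the equation in the form of a fixed point without constant and linear
    coefficients at the base point. *)
Theorem analytic_simple_root (F : R -> {poly R}) n x y :
  (forall t, (size (F t) <= n)%N) ->
  (forall i, real_analytic_at (fun t => (F t)`_i) x) ->
  root (F x) y -> (F x)^`().[y] != 0 ->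
  exists f, [/\ real_analytic_at f x, f x = y & \forall t \near x, root (F t) (f t)].
Proof.
move=> Fn Fx /rootP Fy D0; set D := _.[y] in D0.
pose q := 'X + y%:P; pose H t := 'X - D^-1 *: (F t \Po q).
have FqE t : F t \Po q = \sum_(i < n) (F t)`_i *: q ^+ i.
  rewrite comp_polyE (big_ord_widen _ (fun i => (F t)`_i *: q ^+ i) (Fn t)) big_mkcond.
  apply: eq_bigr => i _; case: ltnP => // /leq_sizeP/(_ _ (leqnn _)) ->.
  by rewrite scale0r.
have Hx m : real_analytic_at (fun t => (H t)`_m) x.
  have : real_analytic_at (fun t => cst (m == 1%N)%:R t -
      cst D^-1 t * \sum_(i < n) (F t)`_i * cst (q ^+ i)`_m t) x.
    apply: analyticB; first exact: analytic_cst.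
    apply: analyticM; first exact: analytic_cst.
    by apply: analytic_sum => i; apply: analyticM => //; exact: analytic_cst.
  apply: near_eq_analytic; near=> t.
  rewrite /H coefB coefX coefZ FqE coef_sum; congr (_ - _ * _).
  by apply: eq_bigr => i _; rewrite coefZ.
have Hn t : (size (H t) <= n.+2)%N.
  rewrite (leq_trans (size_polyD _ _))// geq_max size_polyX size_polyN.
  rewrite (leq_trans (size_scale_leq _ _))// FqE.
  rewrite (leq_trans (size_sum _ _ _))//; apply/bigmax_leqP => i _.
  rewrite (leq_trans (size_scale_leq _ _))// (leq_trans (size_poly_exp_leq _ _))//.
  by rewrite size_XaddC /= mul1n ltnS (leq_trans (ltnW (ltn_ord i))).
have [c [r [C [r0 C1 cH]]]] := common_series n.+2 Hx.
have Hq0 : (F x \Po q).[0] = 0 by rewrite horner_comp /q hornerD hornerX hornerC add0r.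
have [||f [fx f0 fF]] := fixpoint_analytic _ _ r0 C1 cH.
- by rewrite -(has_series_x (cH _ _))// coefB coefX coefZ -horner_coef0 Hq0 mulr0 subr0.
- rewrite -(has_series_x (cH _ _))// coefB coefX coefZ.
  have -> : (F x \Po q)`_1 = D.
    have -> : (F x \Po q)`_1 = (F x \Po q)^`()`_0 by rewrite coef_deriv mulr1n.
    rewrite -horner_coef0 deriv_comp derivD derivX derivC addr0 mulr1 horner_comp.
    by rewrite /q hornerD hornerX hornerC add0r.
  by rewrite mulVf ?subrr.
exists (fun t => f t + y); split.
- by apply: analyticD => //; exact: analytic_cst.
- by rewrite f0 add0r.
near=> t; have : f t = \sum_(m < n.+2) (H t)`_m * f t ^+ m by near: t.
rewrite -(horner_coef_wide _ (Hn t)) /H hornerD hornerX hornerN hornerZ.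
move/eqP; rewrite -subr_eq0 opprD addrA subrr sub0r opprK mulf_eq0 invr_eq0 (negPf D0) /=.
by rewrite horner_comp /q hornerD hornerX hornerC.
Unshelve. all: by end_near.
Qed.

(** Halving the radius pays for the factor [n + 1 <= 2 ^ n] of the derivative. *)
Lemma has_series_diffs a r C g x : has_series a r C g x ->
  forall n, pnorm (r / 2) (trunc (pseries_diffs a) n) <= C / r.
Proof.
move=> [r0 aC _] n; rewrite ler_pdivlMr// (le_trans _ (aC n.+1))// !pnorm_trunc.
rewrite big_ord_recl mulr_suml -[leLHS]add0r lerD ?mulr_ge0//.
apply: ler_sum => i _; rewrite /pseries_diffs normrM normr_nat lift0.
rewrite [leLHS](_ : _ = `|a i.+1| * (i.+1%:R * (r / 2) ^+ i * r)); last by ring.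
rewrite ler_wpM2l// exprSr ler_wpM2r ?(ltW r0)// expr_div_n mulrCA ler_piMr//.
  by rewrite exprn_ge0 ?(ltW r0).
by rewrite ler_pdivrMr ?exprn_gt0// mul1r -natrX ler_nat ltn_expl.
Qed.

Lemma analytic_derive g x : real_analytic_at g x ->
  derivable g x 1 /\ real_analytic_at g^`()%classic x.
Proof.
move=> /real_analyticP[a [r [C ag]]].
have r0 : 0 < r by case: ag.
have bd := has_series_diffs ag.
have r20 : 0 < r / 2 by rewrite divr_gt0.
pose dg t := limn (pseries (pseries_diffs a) (t - x)).
have dag : has_series (pseries_diffs a) (r / 2) (C / r) dg x.
  split=> // t tr; rewrite /dg.
  rewrite (_ : pseries _ _ = fun n => (trunc (pseries_diffs a) n).[t - x]).
    exact: (pnorm_trunc_cvg r20 bd (ltW tr)).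
  by apply/funext => n; rewrite trunc_pseries.
have cvg_at b s D y : 0 < s -> (forall n, pnorm s (trunc b n) <= D) -> 0 <= y -> y <= s ->
    cvgn (pseries b y).
  move=> s0 bD y0 ys.
  rewrite (_ : pseries _ _ = fun n => (trunc b n).[y]); last first.
    by apply/funext => n; rewrite trunc_pseries.
  by apply: pnorm_trunc_cvg s0 bD _; rewrite ger0_norm.
have der t : `|t - x| < r / 4 -> is_derive t 1 g (dg t).
  move=> tr.
  have D : is_derive (t - x) 1 (fun y => limn (pseries a y)) (dg t).
    have [_ aC _] := ag.
    apply: (@pseries_snd_diffs _ _ (r / 4)); last by rewrite [ltRHS]ger0_norm//; lra.
    - by apply: cvg_at r0 aC _ _; lra.
    - by apply: cvg_at r20 bd _ _; lra.
    - by apply: (cvg_at _ (r / 2 / 2) _ _ _ (has_series_diffs dag)); lra.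
  have T := @is_derive1_comp _ _ (fun u : R => u - x) t _ _ D (is_derive_shift t 1 (- x)).
  rewrite mulr1 in T; apply: near_eq_is_derive T.
  have e0 : 0 < r - `|t - x| by lra.
  apply/nbhs_ballP; exists (r - `|t - x|) => //= u.
  rewrite /ball /= => tu; have ux : `|u - x| < r.
    by have := ler_distD t u x; rewrite (distrC u t); lra.
  have [_ _ /(_ u ux) H] := ag; apply: (cvg_lim (@Rhausdorff R)).
  by apply: (cvg_eq_seq H) => m; rewrite trunc_pseries.
have x4 : `|x - x| < r / 4 by rewrite subrr normr0; lra.
split; first by have [] := der _ x4.
apply: (near_eq_analytic (f := dg)); last by apply/real_analyticP; do 3 eexists; exact: dag.
apply/nbhs_ballP; exists (r / 4) => /= [|t]; first lra.
by rewrite /ball /= distrC => /der[_ <-]; rewrite derive1E.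
Qed.

Lemma analytic_continuous g x : real_analytic_at g x -> {for x, continuous g}.
Proof.
by move=> /analytic_derive[/derivable1_diffP/differentiable_continuous].
Qed.

(** The inverse is the simple root of [g X - 1]. *)
Lemma analyticV g x : real_analytic_at g x -> g x != 0 ->
  real_analytic_at (fun t => (g t)^-1) x.
Proof.
move=> gx g0; pose F t : {poly R} := g t *: 'X - 1.
have [||||f [fx _ Ff]] := @analytic_simple_root F 2 x (g x)^-1.
- move=> t; rewrite (leq_trans (size_polyD _ _))// geq_max size_polyN size_poly1 andbT.
  by rewrite (leq_trans (size_scale_leq _ _))// size_polyX.
- move=> i; apply: (near_eq_analytic (f := fun t => g t * cst ('X : {poly R})`_i t
      - cst (1 : {poly R})`_i t)).
    by near=> t; rewrite coefB coefZ.
  by apply: analyticB; [apply: analyticM => //|]; exact: analytic_cst.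
- by rewrite /root /F !hornerE mulfV ?subrr.
- by rewrite derivB derivZ derivX derivC subr0 hornerZ hornerC mulr1.
apply: near_eq_analytic fx; near=> t.
have : root (F t) (f t) by near: t.
rewrite /root /F !hornerE subr_eq0 => /eqP gf.
have gt0 : g t != 0 by apply: contra_eq_neq gf => ->; rewrite mul0r eq_sym oner_eq0.
by apply: (mulfI gt0); rewrite gf mulfV.
Unshelve. all: by end_near.
Qed.

(** The square root is the positive root of [X^2 - g], which is simple. *)
Lemma analytic_sqrt g x : real_analytic_at g x -> 0 < g x ->
  real_analytic_at (fun t => Num.sqrt (g t)) x.
Proof.
move=> gx g0; pose F t : {poly R} := 'X^2 - (g t)%:P.
have [||||f [fx fE Ff]] := @analytic_simple_root F 3 x (Num.sqrt (g x)).
- move=> t; rewrite (leq_trans (size_polyD _ _))// geq_max size_polyN size_polyXn.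
  by rewrite (leq_trans (size_polyC_leq1 _)).
- move=> i; apply: (near_eq_analytic (f := fun t => cst ('X^2 : {poly R})`_i t
      - g t * cst (1 : {poly R})`_i t)).
    by near=> t; rewrite coefB -[(g t)%:P]mulr1 mul_polyC coefZ.
  by apply: analyticB; [|apply: analyticM => //]; exact: analytic_cst.
- by rewrite /root /F !hornerE sqr_sqrtr ?subrr// ltW.
- rewrite derivB derivC subr0 derivXn hornerMn hornerXn expr1 mulrn_eq0 /=.
  by rewrite gt_eqF// sqrtr_gt0.
have f0 : f x > 0 by rewrite fE sqrtr_gt0.
have fpos : \forall t \near x, 0 < f t.
  exact: (cvgr_gt _ (analytic_continuous fx)).
apply: near_eq_analytic fx; near=> t.
have : root (F t) (f t) by near: t.
rewrite /root /F !hornerE subr_eq0 => /eqP <-.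
by rewrite sqrtr_sqr ger0_norm// ltW//; near: t.
Unshelve. all: by end_near.
Qed.

End AnalyticRoots.
(** * Second derivatives at a double zero *)
Section SecondDerivative.
Variable R : realType.
Implicit Types (f g s w : R -> R).

Definition entire f : Prop := forall x, real_analytic_at f x.

Lemma entire_derive f : entire f -> entire f^`()%classic.
Proof. by move=> fe x; have [] := analytic_derive (fe x). Qed.

Lemma entire_derive1M f g : entire f -> entire g ->
  (fun t => f t * g t)^`()%classic = (fun t => f^`()%classic t * g t + f t * g^`()%classic t).
Proof.
move=> fe ge; apply/funext => t.
have [df _] := analytic_derive (fe t); have [dg _] := analytic_derive (ge t).
rewrite derive1E (deriveM df dg) -!derive1E addrC; congr (_ + _).
by rewrite mulrC.
Qed.

Lemma entire_derive1D f g : entire f -> entire g ->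
  (fun t => f t + g t)^`()%classic = (fun t => f^`()%classic t + g^`()%classic t).
Proof.
move=> fe ge; apply/funext => t.
have [df _] := analytic_derive (fe t); have [dg _] := analytic_derive (ge t).
by rewrite derive1E (deriveD df dg) -!derive1E.
Qed.

Lemma entireM f g : entire f -> entire g -> entire (fun t => f t * g t).
Proof. by move=> fe ge x; exact: analyticM. Qed.

Lemma entire_derive2M f g : entire f -> entire g ->
  derive1n 2 (fun t => f t * g t) 0 = derive1n 2 f 0 * g 0
    + 2 * (f^`()%classic 0 * g^`()%classic 0) + f 0 * derive1n 2 g 0.
Proof.
move=> fe ge; rewrite /derive1n /= (entire_derive1M fe ge).
have fe' := entire_derive fe; have ge' := entire_derive ge.
rewrite (entire_derive1D (entireM fe' ge) (entireM fe ge')).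
rewrite (congr1 (fun u : R -> R => u 0) (entire_derive1M fe' ge)).
rewrite (congr1 (fun u : R -> R => u 0) (entire_derive1M fe ge')).
by rewrite mulr_natl mulr2n !addrA.
Qed.

Lemma is_derive_scale (c t : R) : is_derive t 1 (fun u : R => c * u) c.
Proof. by apply: is_derive_eq (is_deriveZ c (is_derive_id t 1)) _; exact: mulr1. Qed.

Lemma derive1_versine (c : R) : (fun t : R => 2 - 2 * cos (c * t))^`()%classic =
  (fun t => 2 * c * sin (c * t)).
Proof.
apply/funext => t; rewrite derive1E.
have H := @is_derive1_comp _ (@cos R) (fun u => c * u) t _ _ (is_derive_cos _) (is_derive_scale c t).
have H2 := is_deriveB (is_derive_cst (2 : R) t 1) (is_deriveZ (2 : R) H).
by rewrite (@derive_val _ _ _ _ _ _ _ H2) sub0r /GRing.scale /=; ring.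
Qed.

Lemma derive2_versine0 (c : R) :
  derive1n 2 (fun t : R => 2 - 2 * cos (c * t)) 0 = 2 * c ^+ 2.
Proof.
rewrite /derive1n /= derive1_versine derive1E.
have H := @is_derive1_comp _ (@sin R) (fun u => c * u) 0 _ _ (is_derive_sin _) (is_derive_scale c 0).
have H2 := is_deriveZ (2 * c) H.
by rewrite (@derive_val _ _ _ _ _ _ _ H2) mulr0 cos0 mul1r /GRing.scale /= expr2 mulrA.
Qed.

(** The versine vanishes to second order at 0, hence so does [s]; by the Leibniz
    rule only the products of a second derivative and a value survive there. *)
Lemma derive2_quotient s f g (c : R) : entire s -> entire f -> entire g ->
  (forall t, s t * f t = (2 - 2 * cos (c * t)) * g t) ->
  s 0 = 0 -> f 0 != 0 -> f 0 = c ^+ 2 * g 0 -> derive1n 2 s 0 = 2.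
Proof.
move=> se fe ge sf s0 f0 fg.
pose w t : R := 2 - 2 * cos (c * t).
have we : entire w.
  move=> x; apply: analyticB; first exact: analytic_cst.
  by apply: analyticM; [exact: analytic_cst|exact: analytic_cosZ].
have w0 : w 0 = 0 by rewrite /w mulr0 cos0 mulr1 subrr.
have w1 : w^`()%classic 0 = 0 by rewrite derive1_versine !mulr0 sin0 mulr0.
have E : (fun t => s t * f t) = (fun t => w t * g t) by apply/funext.
have s1 : s^`()%classic 0 = 0.
  have := congr1 (fun u : R -> R => u^`()%classic 0) E.
  rewrite (congr1 (fun u : R -> R => u 0) (entire_derive1M se fe)).
  rewrite (congr1 (fun u : R -> R => u 0) (entire_derive1M we ge)).
  rewrite w0 w1 s0 !mul0r !addr0 => /eqP; rewrite mulf_eq0 (negPf f0) orbF.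
  by move/eqP.
have H := etrans (esym (entire_derive2M se fe))
  (etrans (congr1 (fun u => derive1n 2 u 0) E) (entire_derive2M we ge)).
have w2 : derive1n 2 w 0 = 2 * c ^+ 2 by exact: derive2_versine0.
have simp (a b u v : R) : a * b + 2 * (0 * u) + 0 * v = a * b.
  by rewrite !mul0r mulr0 !addr0.
rewrite w2 s0 s1 w0 w1 (simp _ (f 0)) (simp _ (g 0)) fg in H.
have c0 : c ^+ 2 * g 0 != 0 by rewrite -fg.
by apply: (mulIf c0); rewrite H -mulrA.
Qed.

End SecondDerivative.
(** * Simple families of Hermitian matrices *)

(** Determinants and adjugates are obtained from the entries by ring operations.
    This is used for functions with values in the complex numbers and in the
    polynomials. *)
Section FunctionSubring.
Variables (R : realType) (S : comNzRingType) (K : (R -> S) -> Prop).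
Hypothesis Kcst : forall c, K (fun=> c).
Hypothesis KD : forall f g, K f -> K g -> K (fun t => f t + g t).
Hypothesis KM : forall f g, K f -> K g -> K (fun t => f t * g t).

Lemma subring_sum (I : Type) (s : seq I) (P : pred I) (F : I -> R -> S) :
  (forall i, K (F i)) -> K (fun t => \sum_(i <- s | P i) F i t).
Proof.
move=> KF; elim: s => [|i s IH].
  by rewrite (_ : (fun t => _) = fun=> 0)//; apply/funext => t; rewrite big_nil.
rewrite (_ : (fun t => _) = fun t => (if P i then F i t else 0) +
    \sum_(i <- s | P i) F i t); last first.
  by apply/funext => t; rewrite big_cons; case: ifP; rewrite ?add0r.
by apply: KD => //; case: (P i).
Qed.

Lemma subring_prod (I : Type) (s : seq I) (P : pred I) (F : I -> R -> S) :
  (forall i, K (F i)) -> K (fun t => \prod_(i <- s | P i) F i t).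
Proof.
move=> KF; elim: s => [|i s IH].
  by rewrite (_ : (fun t => _) = fun=> 1)//; apply/funext => t; rewrite big_nil.
rewrite (_ : (fun t => _) = fun t => (if P i then F i t else 1) *
    \prod_(i <- s | P i) F i t); last first.
  by apply/funext => t; rewrite big_cons; case: ifP; rewrite ?mul1r.
by apply: KM => //; case: (P i).
Qed.

Lemma subring_mulmx m n p (A : R -> 'M[S]_(m, n)) (B : R -> 'M[S]_(n, p)) :
  (forall i j, K (fun t => A t i j)) -> (forall i j, K (fun t => B t i j)) ->
  forall i j, K (fun t => (A t *m B t) i j).
Proof.
move=> KA KB i j.
rewrite (_ : (fun t => _) = fun t => \sum_l A t i l * B t l j).
  by apply: subring_sum => l; exact: KM.
by apply/funext => t; rewrite mxE.
Qed.

Lemma subring_det n (A : R -> 'M[S]_n) :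
  (forall i j, K (fun t => A t i j)) -> K (fun t => \det (A t)).
Proof.
by move=> KA; apply: subring_sum => s; apply: KM => //; apply: subring_prod.
Qed.

Lemma subring_adj n (A : R -> 'M[S]_n) :
  (forall i j, K (fun t => A t i j)) -> forall i j, K (fun t => (\adj (A t)) i j).
Proof.
move=> KA i j.
rewrite (_ : (fun t => _) = fun t => (-1) ^+ (j + i) * \det (row' j (col' i (A t)))).
  apply: KM => //; apply: subring_det => a b.
  by rewrite (_ : (fun t => _) = fun t => A t (lift j a) (lift i b))//;
    apply/funext => t; rewrite !mxE.
by apply/funext => t; rewrite mxE.
Qed.

End FunctionSubring.

Section AnalyticC.
Variable R : realType.
Local Notation C := R[i].
Implicit Types (f g : R -> C) (x : R).

Lemma analyticC_cst (c : C) x : real_analytic_atC (fun=> c) x.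
Proof. by split; exact: analytic_cst. Qed.

Lemma analyticCD f g x : real_analytic_atC f x -> real_analytic_atC g x ->
  real_analytic_atC (fun t => f t + g t) x.
Proof.
move=> [fr fi] [gr gi]; split.
  rewrite (_ : (fun t => _) = fun t => complex.Re (f t) + complex.Re (g t)).
    exact: analyticD.
  by apply/funext => t; case: (f t) (g t) => a b [].
rewrite (_ : (fun t => _) = fun t => complex.Im (f t) + complex.Im (g t)).
  exact: analyticD.
by apply/funext => t; case: (f t) (g t) => a b [].
Qed.

Lemma analyticCM f g x : real_analytic_atC f x -> real_analytic_atC g x ->
  real_analytic_atC (fun t => f t * g t) x.
Proof.
move=> [fr fi] [gr gi]; split.
  rewrite (_ : (fun t => _) = fun t =>
      complex.Re (f t) * complex.Re (g t) - complex.Im (f t) * complex.Im (g t)).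
    by apply: analyticB; exact: analyticM.
  by apply/funext => t; case: (f t) (g t) => a b [].
rewrite (_ : (fun t => _) = fun t =>
    complex.Re (f t) * complex.Im (g t) + complex.Im (f t) * complex.Re (g t)).
  by apply: analyticD; exact: analyticM.
by apply/funext => t; case: (f t) (g t) => a b [].
Qed.

Lemma analyticC_conj f x : real_analytic_atC f x -> real_analytic_atC (fun t => (f t)^*) x.
Proof.
move=> [fr fi]; split.
  rewrite (_ : (fun t => _) = fun t => complex.Re (f t)) //.
  by apply/funext => t; case: (f t).
rewrite (_ : (fun t => _) = fun t => - complex.Im (f t)); first exact: analyticN.
by apply/funext => t; case: (f t).
Qed.

Lemma analyticC_real (f : R -> R) x :
  real_analytic_at f x -> real_analytic_atC (fun t => (f t)%:C) x.
Proof. by move=> fx; split => //; exact: analytic_cst. Qed.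

Lemma analyticC_expi (c : R) x : real_analytic_atC (fun t => expi (c * t)) x.
Proof. by split; [exact: analytic_cosZ|exact: analytic_sinZ]. Qed.

Lemma analytic_char_poly n (A : R -> 'M[C]_n) x :
  (forall i j, real_analytic_atC (fun t => A t i j) x) ->
  forall i, real_analytic_atC (fun t => (char_poly (A t))`_i) x.
Proof.
move=> Ax; pose K (p : R -> {poly C}) := forall i, real_analytic_atC (fun t => (p t)`_i) x.
have Kcst c : K (fun=> c) by move=> i; exact: analyticC_cst.
have KD (f g : R -> {poly C}) : K f -> K g -> K (fun t => f t + g t).
  move=> Kf Kg i; rewrite (_ : (fun t => _) = fun t => (f t)`_i + (g t)`_i).
    exact: analyticCD.
  by apply/funext => t; rewrite coefD.
have KM (f g : R -> {poly C}) : K f -> K g -> K (fun t => f t * g t).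
  move=> Kf Kg i.
  rewrite (_ : (fun t => _) = fun t => \sum_(j < i.+1) (f t)`_j * (g t)`_(i - j)).
    apply: (subring_sum (K := fun f => real_analytic_atC f x)) => [c|u v|j].
    - exact: analyticC_cst.
    - exact: analyticCD.
    - exact: analyticCM.
  by apply/funext => t; rewrite coefM.
apply: (subring_det Kcst KD KM) => i j l.
rewrite (_ : (fun t => _) = fun t => ('X *+ (i == j))`_l + (- (l == 0%N)%:R) * A t i j).
  apply: analyticCD; first exact: analyticC_cst.
  by apply: analyticCM => //; exact: analyticC_cst.
apply/funext => t; rewrite !mxE coefB coefC; case: (l == 0%N).
  by rewrite mulN1r.
by rewrite oppr0 mul0r.
Qed.

End AnalyticC.
Section SimpleHermitian.
Variable R : realType.
Local Notation C := R[i].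

(** Geometric simplicity of the real eigenvalues, which are all the eigenvalues
    of a Hermitian matrix. *)
Definition simple_spectrum n (A : 'M[C]_n) : Prop :=
  forall (s : R) (v w : 'cV[C]_n), v != 0 ->
    A *m v = s%:C *: v -> A *m w = s%:C *: w -> exists c, w = c *: v.

Lemma hermitian_diagonalization n (A : 'M[C]_n) : A^t* = A ->
  exists (P : 'M[C]_n) (d : 'I_n -> R), P \is unitarymx /\
    P *m A = diag_mx (\row_i (d i)%:C) *m P.
Proof.
move=> Ah.
have hA : A \is hermsymmx by apply/is_hermitianmxP; rewrite expr0 scale1r.
have /orthomx_spectralP AE := hermitian_normalmx hA.
have dR := hermitian_spectral_diag_real hA.
move: (spectralmx A) (spectral_diag A) (spectral_unitarymx A) AE dR => P d Pu AE dR.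
exists P, (fun i => complex.Re (d 0 i)); split; first exact: Pu.
rewrite AE -mulmxA mulKVmx; last exact: unitarymx_unit.
congr (_ *m _); congr diag_mx; apply/rowP => i; rewrite mxE.
by rewrite RRe_real//; exact: (mxOverP dR).
Qed.

(** Two equal entries of the diagonalization would give two independent
    eigenvectors of one eigenvalue. *)
Lemma simple_hermitian_spectrum n (A : 'M[C]_n) : A^t* = A -> simple_spectrum A ->
  exists s : seq R, [/\ sorted <%R s, size s = n
    & char_poly A = \prod_(x <- s) ('X - (x%:C)%:P)].
Proof.
move=> Ah As; have [P [d [Pu PA]]] := hermitian_diagonalization Ah.
have PP : P *m P^t* = 1%:M by apply/unitarymxP.
have d_inj : injective d.
  move=> i j dij; apply/eqP/negPn/negP => ij.
  pose u l : 'cV[C]_n := P^t* *m delta_mx l 0.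
  have Pul l : P *m u l = delta_mx l 0 by rewrite mulmxA PP mul1mx.
  have Au l : A *m u l = (d l)%:C *: u l.
    have PV : P^t* *m P = 1%:M by apply: mulmx1C.
    rewrite -[A]mul1mx -PV -!mulmxA (mulmxA P) PA -mulmxA Pul.
    rewrite /u scalemxAr; congr (_ *m _); apply/colP => m; rewrite !mxE.
    rewrite (bigD1 l)//= big1 => [|m' m'l]; last by rewrite !mxE (negPf m'l) mulr0.
    by rewrite !mxE !eqxx mulr1 addr0; case: eqVneq => [->|]; rewrite ?mulr1// mulr0.
  have u0 : u i != 0.
    apply/eqP => /(congr1 (fun u => (P *m u) i 0)); rewrite Pul mulmx0 !mxE !eqxx.
    by move/eqP; rewrite oner_eq0.
  have [|c] := As (d i) _ (u j) u0 (Au i); first by rewrite dij.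
  move/(congr1 (fun u => (P *m u) j 0)); rewrite -scalemxAr !Pul !mxE !eqxx.
  by rewrite (eq_sym j) (negPf ij) mulr0 => /eqP; rewrite oner_eq0.
pose s := sort <=%R [seq d i | i <- enum 'I_n].
have su : uniq s by rewrite sort_uniq map_inj_uniq ?enum_uniq.
have ss : size s = n by rewrite size_sort size_map size_enum_ord.
exists s; split=> //; first by rewrite lt_sorted_uniq_le su sort_le_sorted.
rewrite [LHS](@all_roots_prod_XsubC _ _ [seq x%:C | x <- s]).
- by rewrite (monicP (char_poly_monic A)) scale1r big_map.
- by rewrite size_char_poly size_map ss.
- apply/allP => _ /mapP[x xs ->]; rewrite -eigenvalue_root_char; apply/eigenvalueP.
  move: xs; rewrite mem_sort => /mapP[i _ ->]; exists (row i P).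
    by rewrite -row_mul PA row_mul row_diag_mx -scalemxAl -rowE mxE.
  apply/eqP => Pi0; have /(congr1 (fun M => fun_of_matrix M i i)) := PP.
  have : (row i P *m P^t*) 0 i = 0 by rewrite Pi0 mul0mx mxE.
  rewrite -row_mul mxE => ->; rewrite mxE eqxx => /esym/eqP; by rewrite oner_eq0.
- by rewrite uniq_rootsE map_inj_uniq//; exact: complexI.
Qed.

Lemma char_poly_eigenvector n (A : 'M[C]_n) (s : R) : A^t* = A ->
  root (char_poly A) s%:C -> exists2 v : 'cV[C]_n, v != 0 & A *m v = s%:C *: v.
Proof.
move=> Ah; rewrite -eigenvalue_root_char => /eigenvalueP[w wA w0].
exists (w^t*).
  apply: contra w0 => /eqP w0; apply/eqP/rowP => j.
  have /colP/(_ j) := w0; rewrite !mxE => /eqP; rewrite conjC_eq0 => /eqP ->.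
  by [].
rewrite -{1}Ah -map_mxM -trmx_mul wA; apply/colP => j.
by rewrite !mxE rmorphM /=; congr (_ * _); exact: conjc_real.
Qed.

(** Near a parameter value the implicit function theorem continues each
    eigenvalue analytically. These continuations stay in increasing order and
    there are as many of them as eigenvalues, so that they are the ordered
    eigenvalues. *)
Theorem simple_hermitian_family n (A : R -> 'M[C]_n) :
  (forall x i j, real_analytic_atC (fun t => A t i j) x) ->
  (forall t, (A t)^t* = A t) -> (forall t, simple_spectrum (A t)) ->
  exists s : R -> seq R, [/\ forall t, sorted <%R (s t), forall t, size (s t) = n,
    forall t, char_poly (A t) = \prod_(x <- s t) ('X - (x%:C)%:P)
    & forall i x, (i < n)%N -> real_analytic_at (fun t => nth 0 (s t) i) x].
Proof.
move=> Aan Ah As.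
have /choice[s sP] t := simple_hermitian_spectrum (Ah t) (As t).
have ssort t : sorted <%R (s t) by case: (sP t).
have ssize t : size (s t) = n by case: (sP t).
have schar t : char_poly (A t) = \prod_(x <- s t) ('X - (x%:C)%:P) by case: (sP t).
exists s; split=> // i x ni.
pose F t : {poly R} := \prod_(y <- s t) ('X - y%:P).
have FE t : char_poly (A t) = map_poly (real_complex R) (F t).
  rewrite schar rmorph_prod; apply: eq_bigr => y _.
  by rewrite rmorphB /= map_polyX map_polyC.
have Fsize t : (size (F t) <= n.+1)%N by rewrite size_prod_XsubC ssize.
have Fan j : real_analytic_at (fun t => (F t)`_j) x.
  have [+ _] := analytic_char_poly (Aan x) j.
  by congr real_analytic_at; apply/funext => t; rewrite FE coef_map.
have Froot t y : root (F t) y = (y \in s t) by rewrite root_prod_XsubC.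
have Fsimple y : y \in s x -> (F x)^`().[y] != 0.
  move=> ys; rewrite /F (big_rem y ys) /= derivM derivXsubC mul1r.
  rewrite hornerD hornerM hornerXsubC subrr mul0r addr0 -rootE root_prod_XsubC.
  by rewrite mem_rem_uniq ?inE ?eqxx// lt_sorted_uniq.
have /choice[f fP] (j : 'I_n) : exists f, [/\ real_analytic_at f x,
    f x = nth 0 (s x) j & \forall t \near x, f t \in s t].
  have jx : nth 0 (s x) j \in s x by rewrite mem_nth// ssize.
  have jr : root (F x) (nth 0 (s x) j) by rewrite Froot.
  have [f [fan fx fr]] := analytic_simple_root Fsize Fan jr (Fsimple _ jx).
  exists f; split=> //; near=> t; rewrite -Froot; near: t; exact: fr.
have fan j : real_analytic_at (f j) x by case: (fP j).
have flt (p : 'I_n * 'I_n) : \forall t \near x, (p.1 < p.2)%N -> f p.1 t < f p.2 t.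
  case: p => j l /=.
  have [jl|jl] := boolP (j < l)%N; last by near=> t.
  have D : 0 < f l x - f j x.
    have [_ -> _] := fP l; have [_ -> _] := fP j.
    by rewrite subr_gt0 lt_sorted_ltn_nth// inE ssize.
  have gap : \forall t \near x, 0 < f l t - f j t.
    exact: (cvgr_gt _ (analytic_continuous (analyticB (fan l) (fan j)))).
  by near=> t => _; rewrite -subr_gt0; near: t.
have fs (j : 'I_n) : \forall t \near x, f j t \in s t by case: (fP j).
have /= {}flt := filter_forall _ flt; have /= {}fs := filter_forall _ fs.
apply: near_eq_analytic (fan (Ordinal ni)); near=> t.
have ltt : forall p : 'I_n * 'I_n, (p.1 < p.2)%N -> f p.1 t < f p.2 t.
  by near: t; exact: flt.
have ft : forall j, f j t \in s t by near: t; exact: fs.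
pose l := [seq f j t | j <- enum 'I_n].
have nthl (j : 'I_n) : nth 0 l j = f j t.
  by rewrite (nth_map j) ?size_enum_ord// nth_ord_enum.
have lsize : size l = n by rewrite size_map size_enum_ord.
have lsort : sorted <%R l.
  apply/(sortedP 0) => j; rewrite lsize => jn.
  by rewrite (nthl (Ordinal (ltnW jn))) (nthl (Ordinal jn)) (ltt (_, _)).
have luniq : uniq l by exact: lt_sorted_uniq.
have lsub : {subset l <= s t} by move=> _ /mapP[j _ ->].
have [|_ ls] := uniq_min_size luniq lsub; first by rewrite ssize lsize.
by rewrite -(nthl (Ordinal ni)) (lt_sorted_eq lsort (ssort t) ls).
Unshelve. all: by end_near.
Qed.

End SimpleHermitian.
(** * The spectral problem on an abstract element *)

Section Element.
Variables (R : realType) (n : nat).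
Local Notation C := R[i].
Local Notation cj := (@Num.conj C).
Implicit Types (z : C) (s : R) (u v w q : 'cV[C]_n).

Definition eval (a v : 'cV[C]_n) : C := (a^T *m v) 0 0.

Definition real_mx m p (A : 'M[C]_(m, p)) : Prop := map_mx cj A = A.

(** Nodal evaluations [el_l], [el_r] at the two ends of a cell, differentiation
    [el_d], reflection [el_J] about the midpoint and Gram matrix [el_M]. *)
Record element := Element {
  el_M : 'M[C]_n; el_d : 'M[C]_n; el_J : 'M[C]_n;
  el_l : 'cV[C]_n; el_r : 'cV[C]_n; el_1 : 'cV[C]_n;
  el_M_real : real_mx el_M; el_d_real : real_mx el_d; el_J_real : real_mx el_J;
  el_l_real : real_mx el_l; el_r_real : real_mx el_r; el_1_real : real_mx el_1;
  el_M_sym : el_M^T = el_M;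
  el_M_pos : forall v, v != 0 -> 0 < (v^t* *m el_M *m v) 0 0;
  el_by_parts : el_M *m el_d + el_d^T *m el_M = el_r *m el_r^T - el_l *m el_l^T;
  el_d_eigen : forall z v, z != 0 -> el_d *m (el_d *m v) = z *: v -> v = 0;
  el_d_1 : el_d *m el_1 = 0;
  el_d_ker : forall v, el_d *m v = 0 -> exists c, v = c *: el_1;
  el_r_1 : eval el_r el_1 = 1;
  el_JK : el_J *m el_J = 1%:M;
  el_J_sym : el_J^T = el_J;
  el_J_M : el_J *m el_M = el_M *m el_J;
  el_J_d : el_J *m el_d = - (el_d *m el_J);
  el_J_r : el_J *m el_r = el_l;
  el_J_1 : el_J *m el_1 = el_1 }.

Variable E : element.
Local Notation M := (el_M E).
Local Notation d := (el_d E).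
Local Notation J := (el_J E).
Local Notation l := (el_l E).
Local Notation r := (el_r E).
Local Notation one := (el_1 E).

Lemma evalD a u v : eval a (u + v) = eval a u + eval a v.
Proof. by rewrite /eval mulmxDr mxE. Qed.

Lemma evalZ a c v : eval a (c *: v) = c * eval a v.
Proof. by rewrite /eval -scalemxAr mxE. Qed.

Definition ip u v : C := (u^t* *m M *m v) 0 0.

Lemma ipDr u v w : ip u (v + w) = ip u v + ip u w.
Proof. by rewrite /ip mulmxDr mxE. Qed.

Lemma ipZr u c v : ip u (c *: v) = c * ip u v.
Proof. by rewrite /ip -scalemxAr mxE. Qed.

Lemma trC m p (A : 'M[C]_(m, p)) (i : 'I_p) (j : 'I_m) : cj (A j i) = A^t* i j.
Proof. by rewrite !mxE. Qed.

Lemma herm_mul m p o (A : 'M[C]_(m, p)) (B : 'M[C]_(p, o)) :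
  (A *m B)^t* = B^t* *m A^t*.
Proof. by rewrite trmx_mul map_mxM. Qed.

Lemma real_herm m p (A : 'M[C]_(m, p)) : real_mx A -> A^t* = A^T.
Proof. by move=> Ar; rewrite -map_trmx Ar. Qed.

Lemma ipC u v : cj (ip u v) = ip v u.
Proof.
rewrite /ip trC herm_mul herm_mul trmxCK mulmxA (real_herm (el_M_real E)).
by rewrite el_M_sym.
Qed.

Lemma ipZl u c v : ip (c *: u) v = cj c * ip u v.
Proof. by rewrite -ipC ipZr rmorphM /= ipC. Qed.

Lemma ip_gt0 v : v != 0 -> 0 < ip v v.
Proof. exact: el_M_pos. Qed.

Lemma ip_eq0 v : ip v v = 0 -> v = 0.
Proof.
by move=> v0; apply/eqP/negPn/negP => /ip_gt0; rewrite v0 ltxx.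
Qed.

Lemma el_M_unit : M \in unitmx.
Proof.
rewrite -row_free_unit -kermx_eq0; apply/rowV0P => w /sub_kermxP wM.
have : ip (w^t*) (w^t*) = 0 by rewrite /ip trmxCK wM mul0mx mxE.
move/ip_eq0 => /(congr1 (fun A => A^t*)); rewrite trmxCK => ->.
by rewrite trmx0 map_mx0.
Qed.

(** The Riesz representatives of the two evaluations. *)
Definition delta_l := invmx M *m l.
Definition delta_r := invmx M *m r.

Lemma eval_conj a u : real_mx a -> cj (eval a u) = (u^t* *m a) 0 0.
Proof.
move=> ar; rewrite /eval trC herm_mul (real_herm (A := a^T)) ?trmxK//.
by rewrite /real_mx -map_trmx ar.
Qed.

Lemma ip_delta_l u : ip u delta_l = cj (eval l u).
Proof.
by rewrite /ip /delta_l -mulmxA mulKVmx ?el_M_unit// eval_conj//; exact: el_l_real.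
Qed.

Lemma ip_delta_r u : ip u delta_r = cj (eval r u).
Proof.
by rewrite /ip /delta_r -mulmxA mulKVmx ?el_M_unit// eval_conj//; exact: el_r_real.
Qed.

Lemma ip_by_parts u v : ip (d *m u) v + ip u (d *m v) =
  cj (eval r u) * eval r v - cj (eval l u) * eval l v.
Proof.
have rank1 a : real_mx a ->
    cj (eval a u) * eval a v = (u^t* *m (a *m a^T) *m v) 0 0.
  move=> ar; rewrite (eval_conj _ ar) /eval (mulmxA _ a) -(mulmxA _ a^T).
  by rewrite [RHS]mxE big_ord1.
rewrite (rank1 _ (el_l_real E)) (rank1 _ (el_r_real E)).
have -> : ip (d *m u) v = (u^t* *m (d^T *m M) *m v) 0 0.
  by rewrite /ip herm_mul (real_herm (el_d_real E)) (mulmxA _ _ M).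
have -> : ip u (d *m v) = (u^t* *m (M *m d) *m v) 0 0.
  by rewrite /ip (mulmxA _ M) -(mulmxA _ d).
have addE (A B : 'M[C]_n) :
    (u^t* *m (A + B) *m v) 0 0 = (u^t* *m A *m v) 0 0 + (u^t* *m B *m v) 0 0.
  by rewrite mulmxDr mulmxDl mxE.
have oppE (A : 'M[C]_n) : (u^t* *m (- A) *m v) 0 0 = - (u^t* *m A *m v) 0 0.
  by rewrite mulmxN mulNmx mxE.
by rewrite -oppE -[RHS]addE [LHS]addrC -[LHS]addE el_by_parts.
Qed.

(** The jump of a Bloch wave at the left end of a cell, where the trace from the
    preceding cell is [z] times its trace at the right end; and the jump at the
    right end, against the following cell. *)
Definition jump_l z v : C := eval l v - z * eval r v.
Definition jump_r z v : C := eval r v - cj z * eval l v.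

(** The strong form of the scheme for Bloch waves with phase factor [z]: the
    first equation defines the auxiliary variable [q] of [v], the second one is
    the eigenvalue equation. *)
Definition bloch_pair z s v q : Prop :=
  q = d *m v + jump_l z v *: delta_l /\
  s%:C *: v + d *m q = jump_r z q *: delta_r.

Section Pair.
Variables (z : C) (s : R) (v q : 'cV[C]_n).
Hypothesis zz : z * cj z = 1.
Hypothesis vq : bloch_pair z s v q.

Let sR : cj s%:C = s%:C. Proof. exact: conjc_real. Qed.

(** Pairing each equation with its own unknown and taking real parts leaves
    only boundary terms, which complete squares because [z] is a phase. *)
Lemma bloch_jump_l : ip v q + ip q v = jump_l z v * cj (jump_l z v).
Proof.
have [qE sE] := vq.
have E2 := congr1 (ip v) qE; rewrite ipDr ipZr ip_delta_l in E2.
have E2c := congr1 cj E2; rewrite rmorphD rmorphM /= !ipC conjCK in E2c.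
have Pv := ip_by_parts v v.
have -> : ip v q + ip q v = (cj (eval r v) * eval r v - cj (eval l v) * eval l v) +
    (jump_l z v * cj (eval l v) + cj (jump_l z v) * eval l v).
  by rewrite -Pv E2 E2c; ring.
rewrite /jump_l rmorphB rmorphM /=; ring: zz.
Qed.

Lemma bloch_jump_r : s%:C * (ip v q + ip q v) = jump_r z q * cj (jump_r z q).
Proof.
have [qE sE] := vq.
have E1 := congr1 (ip q) sE; rewrite ipDr !ipZr ip_delta_r in E1.
have E1c := congr1 cj E1; rewrite rmorphD !rmorphM /= sR !ipC conjCK in E1c.
have Pq := ip_by_parts q q.
have -> : s%:C * (ip v q + ip q v) =
    jump_r z q * cj (eval r q) + cj (jump_r z q) * eval r q -
      (cj (eval r q) * eval r q - cj (eval l q) * eval l q).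
  by rewrite -Pq -E1 -E1c; ring.
rewrite /jump_r rmorphB rmorphM /= conjCK; ring: zz.
Qed.

(** The Rayleigh quotient of [v] is a ratio of squared norms, since the two jump
    terms cancel against each other after integration by parts. *)
Lemma bloch_rayleigh : ip q q = s%:C * ip v v.
Proof.
have [qE sE] := vq.
have E1 := congr1 (ip v) sE; rewrite ipDr !ipZr ip_delta_r in E1.
have E1c := congr1 cj E1; rewrite rmorphD !rmorphM /= sR !ipC conjCK in E1c.
have E2 := congr1 (ip q) qE; rewrite ipDr ipZr ip_delta_l in E2.
have P := ip_by_parts q v.
have jq : cj (jump_r z q) = cj (eval r q) - z * cj (eval l q).
  by rewrite rmorphB rmorphM /= conjCK.
rewrite jq in E1c; rewrite E2.
have -> : ip q (d *m v) = cj (eval r q) * eval r v - cj (eval l q) * eval l v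
    - (((cj (eval r q) - z * cj (eval l q)) * eval r v) - s%:C * ip v v).
  by rewrite -P -E1c; ring.
by rewrite /jump_l; ring.
Qed.

Lemma bloch_ge0 : v != 0 -> 0 <= s.
Proof.
move=> v0; have := ip_gt0 v0; have := bloch_rayleigh.
have [->|q0] := eqVneq q 0.
  rewrite /ip mulmx0 mxE => /esym/eqP; rewrite mulf_eq0 => /orP[/eqP[->]//|/eqP ->].
  by rewrite ltxx.
move=> qv vv; have := ip_gt0 q0; rewrite qv pmulr_lgt0// ltcR.
exact: ltW.
Qed.

(** No eigenvector of a nonzero eigenvalue is continuous across the interface:
    it would satisfy [d (d v) = - s v], which no nonzero polynomial does. *)
Lemma bloch_jump_eq0 : s != 0 -> jump_l z v = 0 -> v = 0.
Proof.
move=> s0 jv; have [qE sE] := vq.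
have := bloch_jump_r; rewrite bloch_jump_l jv mul0r mulr0 => /esym/eqP.
rewrite mul_conjC_eq0 => /eqP jq.
rewrite jv scale0r addr0 in qE; rewrite jq scale0r in sE.
apply: (@el_d_eigen E (- s%:C)); first by rewrite oppr_eq0 fmorph_eq0.
by rewrite -qE scaleNr; apply/eqP; rewrite -addr_eq0 addrC sE.
Qed.

Lemma eval_l_1 : eval l one = 1.
Proof.
rewrite -(el_r_1 E) /eval -(el_J_r E) trmx_mul el_J_sym -mulmxA.
by rewrite el_J_1.
Qed.

(** For the eigenvalue 0 the auxiliary variable vanishes, hence so do the jump and
    the derivative of [v]: only constants remain, and a nonzero constant
    has no jump only if the phase is trivial. *)
Lemma bloch_kernel : s = 0 ->
  jump_l z v = 0 /\ exists c, v = c *: one /\ c * (1 - z) = 0.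
Proof.
move=> s0; have [qE _] := vq.
have q0 : q = 0 by apply: ip_eq0; rewrite bloch_rayleigh s0 mul0r.
have jv : jump_l z v = 0.
  apply/eqP; rewrite -mul_conjC_eq0 -bloch_jump_l q0 -(scale0r v).
  by rewrite ipZr ipZl conjC0 !mul0r addr0.
split=> //; have [|c vE] := @el_d_ker E v.
  by move: qE; rewrite jv scale0r addr0 q0.
exists c; split=> //; move: jv; rewrite vE /jump_l !evalZ el_r_1 eval_l_1.
by move=> <-; ring.
Qed.

End Pair.

End Element.
Section Bloch.
Variables (R : realType) (n : nat) (E : element R n).
Local Notation C := R[i].
Local Notation cj := (@Num.conj C).
Local Notation M := (el_M E).
Local Notation d := (el_d E).
Local Notation J := (el_J E).
Local Notation l := (el_l E).
Local Notation r := (el_r E).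
Local Notation one := (el_1 E).
Local Notation ip := (ip E).
Implicit Types (z : C) (s : R) (u v w q p : 'cV[C]_n).

Lemma evalB a v w (c : C) : eval a (w - c *: v) = eval a w - c * eval a v.
Proof. by rewrite evalD -scaleNr evalZ mulNr. Qed.

Lemma bloch_pairB z s v q w p c : bloch_pair E z s v q -> bloch_pair E z s w p ->
  bloch_pair E z s (w - c *: v) (p - c *: q).
Proof.
move=> [qE sE] [pE tE]; split.
  rewrite pE qE /jump_l !evalB mulmxBr -scalemxAr.
  move: (d *m w) (d *m v) (delta_l E) => x y e; apply/colP => i; rewrite !mxE; ring.
rewrite mulmxBr -scalemxAr /jump_r !evalB.
have -> : (eval r p - c * eval r q - cj z * (eval l p - c * eval l q)) =
    jump_r E z p - c * jump_r E z q by rewrite /jump_r; ring.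
rewrite [RHS]scalerBl -scalerA -sE -tE.
move: (d *m q) (d *m p) => x y; apply/colP => i; rewrite !mxE; ring.
Qed.

(** For a nonzero eigenvalue, subtracting a multiple of [v] removes the jump of
    [w], and an eigenvector without jump vanishes; for the eigenvalue 0 both
    waves are constant. *)
Theorem bloch_simple z s v q w p : z * cj z = 1 -> v != 0 ->
  bloch_pair E z s v q -> bloch_pair E z s w p -> exists c, w = c *: v /\ p = c *: q.
Proof.
move=> zz v0 vq wp.
suff [c wE] : exists c, w = c *: v.
  exists c; split=> //; have [-> _] := wp; have [-> _] := vq.
  by rewrite wE /jump_l !evalZ -scalemxAr scalerDr scalerA; congr (_ + _ *: _); ring.
have [s0|s0] := eqVneq s 0.
  have [_ [a [vE _]]] := bloch_kernel zz vq s0; have [_ [b [wE _]]] := bloch_kernel zz wp s0.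
  have a0 : a != 0 by apply: contra v0 => /eqP a0; rewrite vE a0 scale0r.
  by exists (b / a); rewrite wE vE scalerA divfK.
have jv : jump_l E z v != 0.
  by apply: contra v0 => /eqP jv; apply/eqP; apply: (bloch_jump_eq0 zz vq).
exists (jump_l E z w / jump_l E z v); apply/eqP; rewrite -subr_eq0; apply/eqP.
apply: (bloch_jump_eq0 zz (bloch_pairB _ vq wp) s0).
rewrite {1}/jump_l !evalB.
have -> : eval l w - jump_l E z w / jump_l E z v * eval l v -
    z * (eval r w - jump_l E z w / jump_l E z v * eval r v) =
    jump_l E z w - jump_l E z w / jump_l E z v * jump_l E z v by rewrite /jump_l; ring.
by rewrite divfK// subrr.
Qed.

Definition vconj (u : 'cV[C]_n) : 'cV[C]_n := map_mx cj u.

Lemma vconjK u : vconj (vconj u) = u.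
Proof. by apply/colP => i; rewrite !mxE conjCK. Qed.

Lemma vconjD u v : vconj (u + v) = vconj u + vconj v.
Proof. exact: map_mxD. Qed.

Lemma vconjZ c u : vconj (c *: u) = cj c *: vconj u.
Proof. exact: map_mxZ. Qed.

Lemma vconjM (A : 'M[C]_n) u : real_mx A -> vconj (A *m u) = A *m vconj u.
Proof. by move=> Ar; rewrite /vconj map_mxM Ar. Qed.

Lemma eval_vconj a u : real_mx a -> eval a (vconj u) = cj (eval a u).
Proof.
move=> ar; rewrite /eval trC herm_mul mxE [RHS]mxE; apply: eq_bigr => i _.
by rewrite !mxE mulrC -[a in LHS]ar mxE.
Qed.

Lemma el_J_l : J *m l = r.
Proof. by rewrite -(el_J_r E) mulmxA el_JK mul1mx. Qed.

Lemma eval_r_J u : eval r (J *m u) = eval l u.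
Proof. by rewrite /eval mulmxA -(el_J_sym E) -trmx_mul el_J_r. Qed.

Lemma eval_l_J u : eval l (J *m u) = eval r u.
Proof. by rewrite /eval mulmxA -(el_J_sym E) -trmx_mul el_J_l. Qed.

Lemma M_inj u v : M *m u = M *m v -> u = v.
Proof.
by move=> Muv; rewrite -[u](mulKmx (el_M_unit E)) Muv mulKmx ?el_M_unit.
Qed.

Lemma J_delta_r : J *m delta_r E = delta_l E.
Proof.
apply: M_inj; rewrite mulmxA -el_J_M -mulmxA !mulKVmx ?el_M_unit//.
exact: el_J_r.
Qed.

Lemma J_delta_l : J *m delta_l E = delta_r E.
Proof. by rewrite -J_delta_r mulmxA el_JK mul1mx. Qed.

Lemma vconj_delta_l : vconj (delta_l E) = delta_l E.
Proof.
apply: M_inj; rewrite -(vconjM _ (el_M_real E)) !mulKVmx ?el_M_unit//.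
exact: el_l_real.
Qed.

Lemma vconj_delta_r : vconj (delta_r E) = delta_r E.
Proof.
apply: M_inj; rewrite -(vconjM _ (el_M_real E)) !mulKVmx ?el_M_unit//.
exact: el_r_real.
Qed.

Lemma d_J u : d *m (J *m u) = - (J *m (d *m u)).
Proof. by rewrite !mulmxA el_J_d mulNmx opprK. Qed.

(** The two equations use opposite one-sided traces. Reflection exchanges them
    but inverts the phase, which complex conjugation restores; together they
    turn the auxiliary variable of a wave into a wave. *)
Lemma bloch_reflect z s v q : bloch_pair E z s v q ->
  bloch_pair E z s (J *m vconj q) (s%:C *: (J *m vconj v)).
Proof.
move=> [qE sE]; split.
  have := congr1 (fun u => J *m vconj u) sE.
  rewrite vconjD !vconjZ mulmxDr -!scalemxAr vconj_delta_r J_delta_r.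
  rewrite (vconjM _ (el_d_real E)) d_J /jump_l eval_r_J eval_l_J.
  rewrite !eval_vconj; try exact: el_l_real; try exact: el_r_real.
  rewrite /jump_r rmorphB rmorphM /= conjCK => <-.
  by rewrite addrC addrK; congr (_ *: _); symmetry; exact: conjc_real.
have := congr1 (fun u => s%:C *: (J *m vconj u)) qE.
rewrite vconjD !vconjZ mulmxDr -!scalemxAr vconj_delta_l J_delta_l.
rewrite (vconjM _ (el_d_real E)) d_J scalerN => ->.
rewrite /jump_r !evalZ eval_r_J eval_l_J.
rewrite !eval_vconj; try exact: el_l_real; try exact: el_r_real.
rewrite scalerDr addrAC subrr add0r scalerA; congr (_ *: _).
by rewrite /jump_l rmorphB rmorphM /=; ring.
Qed.

(** As the eigenvalue is simple, this antilinear symmetry acts on the eigenline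
    through a scalar [a]; applying it twice multiplies by [s]. *)
Lemma bloch_phase z s v q : z * cj z = 1 -> v != 0 -> bloch_pair E z s v q ->
  exists a : C, [/\ J *m vconj q = a *: v, q = cj a *: (J *m vconj v) & s%:C = a * cj a].
Proof.
move=> zz v0 vq; have [a [H1 H2]] := bloch_simple zz v0 vq (bloch_reflect vq).
have qE : q = cj a *: (J *m vconj v).
  have := congr1 (fun u => J *m vconj u) H1.
  rewrite (vconjM _ (el_J_real E)) vconjK mulmxA el_JK mul1mx => ->.
  by rewrite vconjZ -scalemxAr.
exists a; split=> //.
have : (s%:C - a * cj a) *: (J *m vconj v) = 0.
  by rewrite scalerBl -scalerA -qE H2 subrr.
move/eqP; rewrite scaler_eq0 subr_eq0 => /orP[/eqP//|/eqP Jv].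
move: v0; rewrite -[v]vconjK -[vconj v]mul1mx -(el_JK E) -mulmxA Jv mulmx0.
by rewrite /vconj map_mx0 eqxx.
Qed.

(** Testing the equation of [q] with the constant function. *)
Lemma ip_1_pair z s v q : bloch_pair E z s v q -> ip one q = (1 - z) * eval r v.
Proof.
move=> [qE _]; rewrite qE ipDr ipZr ip_delta_l eval_l_1 conjC1 mulr1.
have := ip_by_parts E one v; rewrite el_d_1 el_r_1 eval_l_1 conjC1 !mul1r.
rewrite -{1}(scale0r one) ipZl conjC0 mul0r add0r => ->.
by rewrite /jump_l; ring.
Qed.

Lemma ip_1_J v : ip one (J *m vconj v) = cj (ip one v).
Proof.
have tr00 (A : 'M[C]_1) : A^T 0 0 = A 0 0 by rewrite mxE.
rewrite ipC /ip (real_herm (el_1_real E)) mulmxA -(mulmxA _ M J) -el_J_M (mulmxA _ J M).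
rewrite -{1}(el_J_sym E) -trmx_mul el_J_1 -[LHS]tr00 trmx_mul trmx_mul trmxK el_M_sym.
by rewrite mulmxA /vconj map_trmx.
Qed.

(** The mean of [q] is [(1 - z)] times a trace of [v], and by the symmetry it is
    also a multiple of the conjugate mean of [v] by a scalar of squared modulus
    [s]. *)
Lemma bloch_mean z s v q : z * cj z = 1 -> v != 0 -> bloch_pair E z s v q ->
  s%:C * (ip one v * cj (ip one v)) =
  (1 - z) * cj (1 - z) * (eval r v * cj (eval r v)).
Proof.
move=> zz v0 vq; have [a [_ qE sE]] := bloch_phase zz v0 vq.
have := ip_1_pair vq.
have -> : ip one q = cj a * cj (ip one v) by rewrite qE ipZr ip_1_J.
move=> H; have Hc := congr1 cj H; rewrite !rmorphM /= !conjCK in Hc.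
rewrite sE; transitivity ((cj a * cj (ip one v)) * (a * ip one v)); first by ring.
by rewrite H Hc; ring.
Qed.

(** The phase multiplies one trace of [v] and one trace of [q] only; the symmetry
    makes the latter vanish together with the former. *)
Lemma bloch_flat z s v q z' : z * cj z = 1 -> v != 0 -> bloch_pair E z s v q ->
  eval r v = 0 -> bloch_pair E z' s v q.
Proof.
move=> zz v0 vq rv; have [a [Jq _ _]] := bloch_phase zz v0 vq.
have lq : eval l q = 0.
  have := congr1 (eval r) Jq; rewrite eval_r_J evalZ rv mulr0.
  rewrite eval_vconj; last exact: el_l_real.
  by move/eqP; rewrite conjC_eq0 => /eqP.
have [qE sE] := vq; split.
  by rewrite {1}qE /jump_l rv !mulr0.
by rewrite sE /jump_r lq !mulr0.
Qed.

End Bloch.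
(** * Bloch matrices and their bands *)
Section BlochMatrix.
Variables (R : realType) (n : nat) (E : element R n).
Local Notation C := R[i].
Local Notation cj := (@Num.conj C).
Local Notation M := (el_M E).
Local Notation d := (el_d E).
Local Notation l := (el_l E).
Local Notation r := (el_r E).
Implicit Types (z : C) (s : R) (u v w q : 'cV[C]_n).

(** The weak form of the map from [v] to its auxiliary variable. *)
Definition bloch_dmx z : 'M[C]_n := M *m d + l *m (l^T - z *: r^T).

Definition bloch_mx z : 'M[C]_n := (bloch_dmx z)^t* *m invmx M *m bloch_dmx z.

Lemma rank1_mul (a b : 'cV[C]_n) u : a *m (b^T *m u) = eval b u *: a.
Proof.
apply/colP => i; rewrite mxE big_ord1 [RHS]mxE mulrC; congr (_ * _).
Qed.

Lemma bloch_dmx_mul z v : invmx M *m (bloch_dmx z *m v) = d *m v + jump_l E z v *: delta_l E.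
Proof.
rewrite /bloch_dmx mulmxDl (mulmxDr (invmx M)) -(mulmxA M) (mulKmx (el_M_unit E)); congr (_ + _).
rewrite -(mulmxA l) mulmxBl mulmxBr -(scalemxAl z r^T) -scalemxAr !rank1_mul scalerA -scalerBl.
by rewrite -scalemxAr.
Qed.

Lemma bloch_dmx_herm z : (bloch_dmx z)^t* = - (M *m d) + r *m (r^T - cj z *: l^T).
Proof.
have hD (A B : 'M[C]_n) : (A + B)^t* = A^t* + B^t* by rewrite linearD map_mxD.
have hB (a b : 'rV[C]_n) c : (a - c *: b)^t* = a^t* - cj c *: b^t*.
  by rewrite linearB linearZ map_mxB map_mxZ.
rewrite /bloch_dmx hD !herm_mul hB (real_herm (el_d_real E)) (real_herm (el_M_real E)).
rewrite el_M_sym (real_herm (el_l_real E)) !(real_herm (A := _^T)) ?trmxK; last 2 first.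
- by rewrite /real_mx -map_trmx (el_r_real E).
- by rewrite /real_mx -map_trmx (el_l_real E).
have -> : d^T *m M = r *m r^T - l *m l^T - M *m d.
  by rewrite -el_by_parts addrC addKr.
rewrite mulmxBl mulmxBr -scalemxAl -scalemxAr.
move: (r *m r^T) (l *m l^T) (M *m d) (r *m l^T) => A1 A2 A3 A4.
apply/matrixP => i j; rewrite !mxE; ring.
Qed.

Lemma bloch_dmx_herm_mul z q :
  (bloch_dmx z)^t* *m q = M *m (- (d *m q) + jump_r E z q *: delta_r E).
Proof.
rewrite bloch_dmx_herm mulmxDl mulNmx (mulmxDr M) mulmxN -(mulmxA M); congr (_ + _).
rewrite -(mulmxA r) mulmxBl mulmxBr -(scalemxAl (cj z) l^T) -scalemxAr !rank1_mul scalerA -scalerBl.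
by rewrite -scalemxAr mulKVmx ?el_M_unit.
Qed.

Lemma bloch_mx_mul z v : bloch_mx z *m v =
  (bloch_dmx z)^t* *m (invmx M *m (bloch_dmx z *m v)).
Proof. by rewrite /bloch_mx -!mulmxA. Qed.

Lemma bloch_mxP z s v : bloch_mx z *m v = s%:C *: (M *m v) <->
  exists q, bloch_pair E z s v q.
Proof.
split=> [Kv|[q [qE sE]]]; last first.
  rewrite bloch_mx_mul bloch_dmx_mul -qE bloch_dmx_herm_mul -sE (scalemxAr _ M).
  by rewrite addrCA addNr addr0.
exists (d *m v + jump_l E z v *: delta_l E); split=> //.
move: Kv; rewrite bloch_mx_mul bloch_dmx_mul bloch_dmx_herm_mul (scalemxAr _ M).
move/M_inj => <-; rewrite [X in X + _]addrC; exact: addrNK.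
Qed.

Lemma bloch_mx_herm z : (bloch_mx z)^t* = bloch_mx z.
Proof.
rewrite /bloch_mx !herm_mul trmxCK mulmxA; congr (_ *m _ *m _).
have : (M *m invmx M)^t* = 1%:M by rewrite mulmxV ?el_M_unit// trmx1 map_mx1.
rewrite herm_mul (real_herm (el_M_real E)) el_M_sym => H.
by rewrite -[LHS]mulmx1 -(mulmxV (el_M_unit E)) mulmxA H mul1mx.
Qed.

(** A congruence by [L] turns the generalized eigenvalue problem into a Hermitian
    one. *)
Lemma el_M_factor : exists2 L : 'M[C]_n, L \in unitmx & L^t* *m L = M.
Proof.
have Mh : M^t* = M by rewrite (real_herm (el_M_real E)) el_M_sym.
have [P [a [Pu PM]]] := hermitian_diagonalization Mh.
have PP : P *m P^t* = 1%:M by apply/unitarymxP.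
have a0 i : 0 < a i.
  pose u : 'cV[C]_n := P^t* *m delta_mx i 0.
  have uE : u^t* = delta_mx 0 i *m P.
    by rewrite herm_mul trmxCK trmx_delta map_delta_mx.
  have u0 : u != 0.
    apply/eqP => /(congr1 (fun u => (P *m u) i 0)).
    by rewrite mulmxA PP mul1mx mulmx0 !mxE !eqxx => /eqP; rewrite oner_eq0.
  have := el_M_pos E u0; rewrite uE -(mulmxA _ P M) PM -!mulmxA /u (mulmxA P) PP mul1mx.
  rewrite -colE -rowE !mxE eqxx mulr1n.
  by rewrite ltcR.
pose L := diag_mx (\row_i (Num.sqrt (a i))%:C) *m P.
have LL : L^t* *m L = M.
  rewrite /L herm_mul -mulmxA (mulmxA _ (diag_mx _) P).
  have -> : (diag_mx (\row_i (Num.sqrt (a i))%:C))^t* *m diag_mx (\row_i (Num.sqrt (a i))%:C)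
      = diag_mx (\row_i (a i)%:C) :> 'M[C]_n.
    rewrite tr_diag_mx map_diag_mx mulmx_diag; congr diag_mx; apply/rowP => i.
    rewrite !mxE -[RHS](_ : (Num.sqrt (a i))%:C * (Num.sqrt (a i))%:C = _).
      by congr (_ * _); exact: conjc_real.
    by rewrite -rmorphM -expr2 sqr_sqrtr// ltW.
  have PV : P^t* *m P = 1%:M by exact: mulmx1C.
  by rewrite -PM mulmxA PV mul1mx.
exists L => //; have := el_M_unit E; rewrite -LL unitmx_mul => /andP[_]; exact.
Qed.

End BlochMatrix.
Section Bands.
Variables (R : realType) (n : nat) (E : element R n).
Local Notation C := R[i].
Local Notation cj := (@Num.conj C).
Local Notation M := (el_M E).
Implicit Types (s x t : R) (u v w q : 'cV[C]_n).

Definition analytic_mx m p (A : R -> 'M[C]_(m, p)) x : Prop :=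
  forall i j, real_analytic_atC (fun t => A t i j) x.

Lemma analytic_mx_cst m p (A : 'M[C]_(m, p)) x : analytic_mx (fun=> A) x.
Proof. by move=> i j; exact: analyticC_cst. Qed.

Lemma analytic_mxD m p (A B : R -> 'M[C]_(m, p)) x :
  analytic_mx A x -> analytic_mx B x -> analytic_mx (fun t => A t + B t) x.
Proof.
move=> Ax Bx i j; have := analyticCD (Ax i j) (Bx i j).
by congr real_analytic_atC; apply/funext => t; rewrite mxE.
Qed.

Lemma analytic_mxZ m p (f : R -> C) (A : R -> 'M[C]_(m, p)) x :
  real_analytic_atC f x -> analytic_mx A x -> analytic_mx (fun t => f t *: A t) x.
Proof.
move=> fx Ax i j; have := analyticCM fx (Ax i j).
by congr real_analytic_atC; apply/funext => t; rewrite mxE.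
Qed.

Lemma analytic_mxM m p o (A : R -> 'M[C]_(m, p)) (B : R -> 'M[C]_(p, o)) x :
  analytic_mx A x -> analytic_mx B x -> analytic_mx (fun t => A t *m B t) x.
Proof.
move=> Ax Bx; apply: (subring_mulmx (K := fun f => real_analytic_atC f x)) => //.
- by move=> c; exact: analyticC_cst.
- by move=> f g; exact: analyticCD.
- by move=> f g; exact: analyticCM.
Qed.

Lemma analytic_mx_adj m (A : R -> 'M[C]_m) x :
  analytic_mx A x -> analytic_mx (fun t => \adj (A t)) x.
Proof.
move=> Ax; apply: (subring_adj (K := fun f => real_analytic_atC f x)) => //.
- by move=> c; exact: analyticC_cst.
- by move=> f g; exact: analyticCD.
- by move=> f g; exact: analyticCM.
Qed.

Lemma analytic_mx_herm m p (A : R -> 'M[C]_(m, p)) x :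
  analytic_mx A x -> analytic_mx (fun t => (A t)^t*) x.
Proof.
move=> Ax i j; have := analyticC_conj (Ax j i).
by congr real_analytic_atC; apply/funext => t; rewrite !mxE.
Qed.

Variable z : R -> C.
Hypothesis z_an : forall x, real_analytic_atC z x.
Hypothesis zz : forall t, z t * cj (z t) = 1.

Lemma analytic_bloch_mx x : analytic_mx (fun t => bloch_mx E (z t)) x.
Proof.
have Dx : analytic_mx (fun t => bloch_dmx E (z t)) x.
  apply: analytic_mxD; first exact: analytic_mx_cst.
  apply: analytic_mxM; first exact: analytic_mx_cst.
  have H : analytic_mx (fun t => (el_l E)^T + (- z t) *: (el_r E)^T) x.
    apply: analytic_mxD; first exact: analytic_mx_cst.
    apply: analytic_mxZ; last exact: analytic_mx_cst.
    have := analyticCM (analyticC_cst (-1) x) (z_an x).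
    by congr real_analytic_atC; apply/funext => t; rewrite mulN1r.
  move=> i j; have := H i j.
  by congr real_analytic_atC; apply/funext => t; rewrite scaleNr.
apply: analytic_mxM; last exact: Dx.
apply: analytic_mxM; last exact: analytic_mx_cst.
exact: analytic_mx_herm Dx.
Qed.

(** All eigenvalues are simple, for every phase, so they never cross and
    their natural numbering by size is analytic. *)
Theorem bloch_bands : exists sig : R -> seq R, [/\ forall t, sorted <%R (sig t),
  forall t, size (sig t) = n,
  forall t s, s \in sig t <-> exists v q, v != 0 /\ bloch_pair E (z t) s v q
  & forall i x, (i < n)%N -> real_analytic_at (fun t => nth 0 (sig t) i) x].
Proof.
have [L Lu LL] := el_M_factor E.
pose A t := (invmx L)^t* *m bloch_mx E (z t) *m invmx L.
have LV : (invmx L)^t* *m L^t* = 1%:M.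
  by rewrite -herm_mul mulmxV// trmx1 map_mx1.
have LV' : L^t* *m (invmx L)^t* = 1%:M by exact: mulmx1C.
have AP t s (y : 'cV[C]_n) : A t *m y = s%:C *: y <->
    bloch_mx E (z t) *m (invmx L *m y) = s%:C *: (M *m (invmx L *m y)).
  have My : M *m (invmx L *m y) = L^t* *m y by rewrite -LL -(mulmxA (L^t*)) mulKVmx.
  rewrite My; split=> [Ay|Ky].
    have := congr1 (mulmx (L^t*)) Ay; rewrite /A -(mulmxA _ (invmx L)) -(mulmxA _ (bloch_mx E (z t))) (mulmxA (L^t*)) LV' mul1mx => ->.
    by rewrite scalemxAr.
  rewrite /A -(mulmxA _ (invmx L)) -(mulmxA _ (bloch_mx E (z t))) Ky -scalemxAr mulmxA LV mul1mx.
  by [].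
have Ah t : (A t)^t* = A t.
  rewrite /A (herm_mul _ (invmx L)) (herm_mul _ (bloch_mx E (z t))) trmxCK bloch_mx_herm.
  rewrite mulmxA.
  by [].
have As t : simple_spectrum (A t).
  move=> s v w v0 /AP/bloch_mxP[q vq] /AP/bloch_mxP[p wp].
  have [|c [wE _]] := bloch_simple (zz t) _ vq wp.
    apply: contra v0 => /eqP Lv; apply/eqP.
    by rewrite -[v](mulKVmx Lu) Lv mulmx0.
  by exists c; rewrite -[w](mulKVmx Lu) wE -scalemxAr mulKVmx.
have Aan x : analytic_mx A x.
  apply: analytic_mxM; last exact: analytic_mx_cst.
  by apply: analytic_mxM; [exact: analytic_mx_cst|exact: analytic_bloch_mx].
have [sig [ssort ssize schar san]] := simple_hermitian_family Aan Ah As.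
exists sig; split=> // t s.
have rootE : root (char_poly (A t)) s%:C = (s \in sig t).
  rewrite schar -(big_map (real_complex R) xpredT (fun c => 'X - c%:P)).
  by rewrite root_prod_XsubC mem_map//; exact: complexI.
split=> [|[v [q [v0 vq]]]].
  rewrite -rootE => /(char_poly_eigenvector (Ah t))[y y0 /AP/bloch_mxP[q yq]].
  exists (invmx L *m y), q; split=> //.
  apply: contra y0 => /eqP Ly; apply/eqP.
  by rewrite -[y](mulKVmx Lu) Ly mulmx0.
rewrite -rootE -eigenvalue_root_char; apply/eigenvalueP.
have Lv : A t *m (L *m v) = s%:C *: (L *m v).
  by apply/AP; rewrite mulKmx//; apply/bloch_mxP; exists q.
exists ((L *m v)^t*).
  rewrite -{1}Ah -herm_mul Lv linearZ map_mxZ; congr (_ *: _).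
  exact: conjc_real.
apply: contra v0 => /eqP Lv0; apply/eqP.
rewrite -[v](mulKmx Lu) -[L *m v]trmxCK Lv0 trmx0 map_mx0 mulmx0.
by [].
Qed.

End Bands.
Section Eigenvectors.
Variables (R : realType).
Local Notation C := R[i].
Local Notation cj := (@Num.conj C).

(** Bordering a Hermitian matrix whose kernel is a line by a functional that
    does not vanish on this line makes it invertible, and Cramer's rule solves
    the bordered system without division. *)
Lemma analytic_kernel m (B : R -> 'M[C]_m) (f : R -> 'rV[C]_m) :
  (forall x, analytic_mx B x) -> (forall x, analytic_mx f x) ->
  (forall t, (B t)^t* = B t) ->
  (forall t, exists v : 'cV[C]_m, [/\ v != 0, B t *m v = 0 &
     forall w : 'cV[C]_m, B t *m w = 0 -> exists c, w = c *: v]) ->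
  (forall t (v : 'cV[C]_m), v != 0 -> B t *m v = 0 -> (f t *m v) 0 0 != 0) ->
  exists u : R -> 'cV[C]_m, (forall x, analytic_mx u x) /\
    forall t, u t != 0 /\ B t *m u t = 0.
Proof.
move=> Ban fan Bh Bker fker.
pose N t := B t + (f t)^t* *m f t.
exists (fun t => \adj (N t) *m (f t)^t*); split=> [x|t].
  apply: analytic_mxM; last exact: analytic_mx_herm.
  apply: analytic_mx_adj; apply: analytic_mxD => //.
  by apply: analytic_mxM => //; exact: analytic_mx_herm.
have [v [v0 Bv vker]] := Bker t; have fv := fker t v v0 Bv.
have vB : v^t* *m B t = 0 by rewrite -Bh -herm_mul Bv trmx0 map_mx0.
have vNE (w : 'cV[C]_m) : v^t* *m (N t *m w) = cj ((f t *m v) 0 0) *: (f t *m w).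
  rewrite /N mulmxDl mulmxDr (mulmxA (v^t*)) vB mul0mx add0r -(mulmxA _ (f t)) (mulmxA (v^t*)) -herm_mul.
  by rewrite [X in X *m _ = _]mx11_scalar mul_scalar_mx trC.
have det0 : \det (N t) != 0.
  apply/negP => /det0P[y y0 yN].
  have Ny : N t *m y^t* = 0.
    have Nh : (N t)^t* = N t.
      by rewrite /N linearD map_mxD herm_mul trmxCK Bh.
    by rewrite -Nh -herm_mul yN trmx0 map_mx0.
  have fy : f t *m y^t* = 0.
    have := vNE (y^t*); rewrite Ny mulmx0 => /esym/eqP.
    by rewrite scaler_eq0 conjC_eq0 (negPf fv) => /eqP.
  have By : B t *m y^t* = 0.
    by move: Ny; rewrite /N mulmxDl -mulmxA fy mulmx0 addr0.
  have [c yE] := vker _ By.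
  have c0 : c = 0.
    move/eqP: fy; rewrite yE -scalemxAr scaler_eq0 => /orP[/eqP//|/eqP fv0].
    by move: fv; rewrite fv0 mxE eqxx.
  by move: y0; rewrite -[y]trmxCK yE c0 scale0r trmx0 map_mx0 eqxx.
set u := \adj (N t) *m _.
have Nu : N t *m u = \det (N t) *: (f t)^t* by rewrite mulmxA mul_mx_adj mul_scalar_mx.
have fu : (f t *m u) 0 0 = \det (N t).
  have := vNE u; rewrite Nu -scalemxAr -herm_mul => /(congr1 (fun A => fun_of_matrix A 0 0)).
  rewrite [LHS]mxE [RHS]mxE -trC mulrC => /mulfI H.
  by apply/esym/H; rewrite conjC_eq0.
split.
  by apply: contra det0 => /eqP u0; rewrite -fu u0 mulmx0 mxE.
move: Nu; rewrite /N mulmxDl -mulmxA [f t *m u]mx11_scalar fu mul_mx_scalar => H.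
by apply: (addIr (\det (N t) *: (f t)^t*)); rewrite add0r H.
Qed.

End Eigenvectors.

Section BlochFrame.
Variables (R : realType) (n : nat) (E : element R n).
Local Notation C := R[i].
Local Notation cj := (@Num.conj C).
Local Notation M := (el_M E).
Local Notation l := (el_l E).
Local Notation r := (el_r E).
Local Notation one := (el_1 E).
Local Notation ip := (ip E).
Implicit Types (s x t : R) (u v w q : 'cV[C]_n).

Lemma analytic_normalized (u : R -> 'cV[C]_n) : (forall x, analytic_mx u x) -> (forall t : R, u t != 0) ->
  exists v : R -> 'cV[C]_n, [/\ forall x, analytic_mx v x,
    forall t, ip (v t) (v t) = 1 & forall t, exists2 c : C, c != 0 & v t = c *: u t].
Proof.
move=> uan u0; pose g t := complex.Re (ip (u t) (u t)).
have gE t : (g t)%:C = ip (u t) (u t).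
  by apply: RRe_real; rewrite gtr0_real// ip_gt0.
have g0 t : 0 < g t by rewrite -ltcR gE ip_gt0.
have gan x : real_analytic_at g x.
  have H : analytic_mx (fun t => (u t)^t* *m M *m u t) x.
    apply: analytic_mxM; last exact: uan.
    apply: analytic_mxM; last exact: analytic_mx_cst.
    exact: analytic_mx_herm.
  by have [] := H 0 0.
pose c t : R := (Num.sqrt (g t))^-1.
have c0 t : c t != 0 by rewrite invr_eq0 gt_eqF// sqrtr_gt0.
exists (fun t => (c t)%:C *: u t); split=> [x|t|t].
- apply: analytic_mxZ; last exact: uan.
  apply: analyticC_real; apply: analyticV; last by rewrite gt_eqF// sqrtr_gt0.
  exact: analytic_sqrt.
- have cR : cj (c t)%:C = (c t)%:C by exact: conjc_real.
  rewrite ipZl ipZr cR -gE -!rmorphM; apply/eqP; rewrite -(rmorph1 (real_complex R)).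
  rewrite (inj_eq (@complexI R)) mulrA -expr2 /c exprVn sqr_sqrtr ?(ltW (g0 t))//.
  by rewrite mulVf// gt_eqF.
- by exists (c t)%:C => //; rewrite fmorph_eq0.
Qed.

Lemma bloch_orthogonal z s s' v w q p : z * cj z = 1 ->
  bloch_pair E z s v q -> bloch_pair E z s' w p -> s != s' -> ip v w = 0.
Proof.
move=> zz vq wp ss'.
have Kv : bloch_mx E z *m v = s%:C *: (M *m v) by apply/bloch_mxP; exists q.
have Kw : bloch_mx E z *m w = s'%:C *: (M *m w) by apply/bloch_mxP; exists p.
have H1 : (v^t* *m (bloch_mx E z *m w)) 0 0 = s'%:C * ip v w.
  by rewrite Kw -scalemxAr mulmxA mxE.
have H2 : (v^t* *m (bloch_mx E z *m w)) 0 0 = s%:C * ip v w.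
  rewrite -{1}bloch_mx_herm mulmxA -herm_mul Kv linearZ map_mxZ -scalemxAl mxE.
  rewrite herm_mul (real_herm (el_M_real E)) el_M_sym; congr (_ * _).
  exact: conjc_real.
move/eqP: H1; rewrite H2 -subr_eq0 -mulrBl mulf_eq0 subr_eq0 (inj_eq (@complexI R)).
by rewrite (negPf ss') => /eqP.
Qed.

Lemma bloch_conj z s v q : bloch_pair E z s v q ->
  bloch_pair E (cj z) s (vconj v) (vconj q).
Proof.
move=> [qE sE]; split.
  rewrite {1}qE vconjD vconjZ vconj_delta_l (vconjM _ (el_d_real E)); congr (_ + _ *: _).
  by rewrite /jump_l rmorphB rmorphM /= !eval_vconj//; [exact: el_r_real|exact: el_l_real].
have := congr1 (@vconj R n) sE.
rewrite vconjD !vconjZ vconj_delta_r (vconjM _ (el_d_real E)).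
have -> : cj s%:C = s%:C by exact: conjc_real.
move=> ->; congr (_ *: _).
by rewrite /jump_r rmorphB rmorphM /= !eval_vconj//; [exact: el_l_real|exact: el_r_real].
Qed.

Variable z : R -> C.
Hypothesis z_an : forall x, real_analytic_atC z x.
Hypothesis zz : forall t, z t * cj (z t) = 1.
Hypothesis z0 : z 0 = 1.
Variable sig : R -> seq R.
Hypothesis sig_sorted : forall t, sorted <%R (sig t).
Hypothesis sig_size : forall t, size (sig t) = n.
Hypothesis sigP : forall t s, s \in sig t <->
  exists v q, v != 0 /\ bloch_pair E (z t) s v q.
Hypothesis sig_an : forall i x, (i < n)%N -> real_analytic_at (fun t => nth 0 (sig t) i) x.
Hypothesis n0 : (0 < n)%N.

(** Conjugating a wave conjugates its phase and keeps its eigenvalue. *)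
Lemma band_even t : z (- t) = cj (z t) -> sig (- t) = sig t.
Proof.
move=> zN; apply: lt_sorted_eq => // s; apply/idP/idP => /sigP[v [q [v0 vq]]]; apply/sigP.
  exists (vconj v), (vconj q); split.
    by apply: contra v0 => /eqP Jv; rewrite -[v]vconjK Jv /vconj map_mx0.
  by have := bloch_conj vq; rewrite zN conjCK.
exists (vconj v), (vconj q); split.
  by apply: contra v0 => /eqP Jv; rewrite -[v]vconjK Jv /vconj map_mx0.
by have := bloch_conj vq; rewrite -zN.
Qed.

Lemma band_ge0 t s : s \in sig t -> 0 <= s.
Proof. by move=> /sigP[v [q [v0 vq]]]; exact: (bloch_ge0 vq v0). Qed.

Lemma band_lt t i j : (i < j < n)%N -> nth 0 (sig t) i < nth 0 (sig t) j.
Proof.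
by move=> /andP[ij jn]; rewrite lt_sorted_ltn_nth// inE sig_size// (ltn_trans ij).
Qed.

Lemma band_mem t i : (i < n)%N -> nth 0 (sig t) i \in sig t.
Proof. by move=> ni; rewrite mem_nth// sig_size. Qed.

Lemma band_0_0 : nth 0 (sig 0) 0 = 0.
Proof.
have one0 : one != 0.
  by apply/eqP => one0; have := el_r_1 E; rewrite /eval one0 mulmx0 mxE => /eqP; rewrite eq_sym oner_eq0.
have sig0 : 0 \in sig 0.
  apply/sigP; exists one, 0; split=> //; split.
    by rewrite el_d_1 add0r /jump_l z0 el_r_1 eval_l_1 mul1r subrr scale0r.
  by rewrite mulmx0 /jump_r /eval !mulmx0 mxE mulr0 subrr !scale0r addr0.
apply/eqP; rewrite eq_le (band_ge0 (band_mem 0 n0)) andbT.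
have [j jn jE] := nthP 0 sig0.
apply: (@le_trans _ _ (nth 0 (sig 0) j)); last by rewrite jE.
have [->//|j0] := posnP j.
by rewrite ltW// band_lt// j0 -(sig_size 0).
Qed.

Lemma band_pos t i : (0 < i < n)%N -> 0 < nth 0 (sig t) i.
Proof.
move=> /andP[i0 ni]; rewrite (le_lt_trans (band_ge0 (band_mem t n0)))// band_lt//.
by rewrite i0.
Qed.

(** If a wave of the lowest band vanished at the end of the cell, its
    eigenvalue [s] would be an eigenvalue for every phase. The lowest eigenvalue
    is [s] exactly where all the other ones exceed [s], so the parameters
    at which this happens would form an open and closed set; but [s] is
    positive and the lowest eigenvalue at 0 is 0. *)
Lemma lowest_band_trace t v q : v != 0 -> bloch_pair E (z t) (nth 0 (sig t) 0) v q ->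
  eval r v != 0.
Proof.
move=> v0 vq; apply/negP => /eqP rv; set s := nth 0 (sig t) 0 in vq.
have s0 : s != 0.
  apply/eqP => s0; have [_ [c [vE _]]] := bloch_kernel (zz t) vq s0.
  move: v0 rv; rewrite vE evalZ el_r_1 mulr1 => /[swap] ->.
  by rewrite scale0r eqxx.
have flat t' : s \in sig t'.
  by apply/sigP; exists v, q; split=> //; exact: (bloch_flat _ (zz t) v0 vq rv).
pose B := [set t' : R | nth 0 (sig t') 0 = s].
have Bopen : open B.
  rewrite openE => t' Bt'.
  have H (i : 'I_n) : \forall u \near t', (0 < i)%N -> s < nth 0 (sig u) i.
    have [i0|i0] := posnP i; first by near=> u; rewrite i0.
    have sl : s < nth 0 (sig t') i by rewrite -Bt' band_lt// i0 ltn_ord.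
    have G : \forall u \near t', s < nth 0 (sig u) i.
      exact: (cvgr_gt _ (analytic_continuous (sig_an t' (ltn_ord i)))).
    by near=> u => _; near: u.
  have /= H' := filter_forall _ H; rewrite /interior /=; near=> u.
  have Hu : forall i : 'I_n, (0 < i)%N -> s < nth 0 (sig u) i by near: u; exact: H'.
  have [j jn js] := nthP 0 (flat u); rewrite /B /= -js.
  have [->//|j0] := posnP j; rewrite sig_size in jn.
  by have := Hu (Ordinal jn) j0; rewrite js ltxx.
have Bclosed : closed B.
  have -> : B = (fun t' => nth 0 (sig t') 0) @^-1` [set s] by [].
  apply: closed_comp => [x _|]; last exact: closed_eq.
  exact: (analytic_continuous (sig_an x n0)).
have cT : connected [set: R] by apply/connected_intervalP.
have BT : B = [set: R].
  apply: cT; first by exists t.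
    by exists B => //; rewrite setTI.
  by exists B => //; rewrite setTI.
have : B 0 by rewrite BT.
by rewrite /B /= band_0_0 => /esym/eqP; rewrite (negPf s0).
Unshelve. all: by end_near.
Qed.

End BlochFrame.
(** * Integrals and traces of piecewise polynomials *)

Section PolyIntegral.
Variable R : realType.
Local Notation mu := (@lebesgue_measure R).
Implicit Types (p P : {poly R}) (a b : R).

Lemma poly_integrable p a b :
  mu.-integrable `[a, b] (EFin \o horner p).
Proof.
apply: continuous_compact_integrable; first exact: segment_compact.
by apply: continuous_subspaceT => x; exact: continuous_horner.
Qed.

Lemma Rintegral_poly p P a b : a < b -> P^`() = p ->
  (\int[mu]_(x in [set x | a < x < b]) p.[x])%R = P.[b] - P.[a].
Proof.
move=> ab Pp; have -> : [set x | a < x < b] = `]a, b[%classic by rewrite set_itvoo.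
rewrite Rintegral_itv_bndo_bndc; last first.
  by apply: integrableS (poly_integrable p a b) => //; exact: subset_itv_oo_cc.
rewrite Rintegral_itv_obnd_cbnd; last first.
  by apply: integrableS (poly_integrable p a b) => //; exact: subset_itv_oc_cc.
rewrite /Rintegral (@continuous_FTC2 _ (horner p) (horner P)) //.
- by apply: continuous_subspaceT => x; exact: continuous_horner.
- split=> [x _||]; first exact: derivable_horner.
  + by apply: cvg_at_right_filter; exact: continuous_horner.
  + by apply: cvg_at_left_filter; exact: continuous_horner.
- by move=> x _; rewrite -derivE Pp.
Qed.

(** The primitive of a nonnegative polynomial is nondecreasing; if it takes the
    same value at both ends it is constant in between, at infinitely many
    points. *)
Lemma poly_monotone_eq p P a b : a < b -> P^`() = p -> (forall x, 0 <= p.[x]) ->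
  P.[b] <= P.[a] -> p = 0.
Proof.
move=> ab Pp p0 Pba.
have incr x y : x < y -> P.[x] <= P.[y].
  move=> xy; rewrite -subr_ge0 -(Rintegral_poly xy Pp).
  by apply: Rintegral_ge0.
pose Q := P - (P.[a])%:P.
have Q0 x : a < x < b -> root Q x.
  move=> /andP[ax xb]; rewrite /root /Q !hornerE subr_eq0 eq_le (incr _ _ ax) andbT.
  exact: le_trans (incr _ _ xb) Pba.
suff Q0' : Q = 0 by rewrite -Pp -[P](subrK (P.[a])%:P) -/Q Q0' add0r derivC.
apply/eqP/negPn/negP => /max_poly_roots Qr.
pose rs := [seq a + (b - a) / i.+2%:R | i <- iota 0 (size Q)].
have /Qr : all (root Q) rs.
  apply/allP => _ /mapP[i _ ->]; apply: Q0.
  have b0 : 0 < b - a by rewrite subr_gt0.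
  rewrite ltrDl divr_gt0//= -ltrBrDl gtr_pMr// invf_lt1// ltr1n.
  by [].
have urs : uniq rs.
  rewrite map_inj_uniq ?iota_uniq// => i j /addrI.
  have b0 : b - a != 0 by rewrite subr_eq0 gt_eqF.
  move=> /(mulfI b0)/invr_inj/eqP; rewrite eqr_nat => /eqP; by case.
by move=> /(_ urs); rewrite size_map size_iota ltnn.
Qed.

Local Notation C := R[i].

Definition Re_poly (p : {poly C}) : {poly R} := map_poly (@complex.Re R) p.
Definition Im_poly (p : {poly C}) : {poly R} := map_poly (@complex.Im R) p.

Lemma coef_Re_poly (p : {poly C}) i : (Re_poly p)`_i = complex.Re p`_i.
Proof. by rewrite coef_map. Qed.

Lemma coef_Im_poly (p : {poly C}) i : (Im_poly p)`_i = complex.Im p`_i.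
Proof. by rewrite coef_map. Qed.

Lemma complex_ext (z w : C) :
  complex.Re z = complex.Re w -> complex.Im z = complex.Im w -> z = w.
Proof. by case: z w => a b [c d] /= -> ->. Qed.

Lemma poly_ReIm (p : {poly C}) :
  p = map_poly (real_complex R) (Re_poly p) + 'i%C *: map_poly (real_complex R) (Im_poly p).
Proof.
apply/polyP => i; rewrite coefD coefZ !coef_map /=.
by case: p`_i => a b; apply: complex_ext => /=; ring.
Qed.

Lemma horner_ReIm (p : {poly C}) (x : R) :
  p.[x%:C] = (Re_poly p).[x] +i* (Im_poly p).[x].
Proof.
rewrite {1}(poly_ReIm p) hornerD hornerZ !horner_map /=.
by apply: complex_ext => /=; ring.
Qed.

Lemma intC_poly (p P : {poly C}) a b : a < b -> P^`() = p ->
  intC [set x | a < x < b] (fun x => p.[x%:C]) = P.[b%:C] - P.[a%:C].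
Proof.
move=> ab Pp; rewrite /intC !horner_ReIm.
have -> : (fun x : R => complex.Re p.[x%:C]) = horner (Re_poly p).
  by apply/funext => x; rewrite horner_ReIm.
have -> : (fun x : R => complex.Im p.[x%:C]) = horner (Im_poly p).
  by apply/funext => x; rewrite horner_ReIm.
rewrite (@Rintegral_poly _ (Re_poly P))//; last first.
  by apply/polyP => i; rewrite coef_deriv !coef_Re_poly -Pp coef_deriv raddfMn.
rewrite (@Rintegral_poly _ (Im_poly P))//.
by apply/polyP => i; rewrite coef_deriv !coef_Im_poly -Pp coef_deriv raddfMn.
Qed.

Lemma limC_unique (F : set_system R) {FF : ProperFilter F} (f : R -> C) (p : {poly C}) a :
  F --> a -> (\forall x \near F, f x = p.[x%:C]) -> limC F f = p.[a%:C].
Proof.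
move=> Fa fp; rewrite horner_ReIm /limC; congr (_ +i* _); apply: cvg_lim => //.
  have H : (Re_poly p).[x] @[x --> F] --> (Re_poly p).[a].
    by apply: continuous_cvg => //; exact: continuous_horner.
  apply: cvg_trans H; apply: near_eq_cvg; near=> x.
  have -> : f x = p.[x%:C] by near: x.
by rewrite horner_ReIm.
have H : (Im_poly p).[x] @[x --> F] --> (Im_poly p).[a].
  by apply: continuous_cvg => //; exact: continuous_horner.
apply: cvg_trans H; apply: near_eq_cvg; near=> x.
have -> : f x = p.[x%:C] by near: x.
by rewrite horner_ReIm.
Unshelve. all: by end_near.
Qed.

End PolyIntegral.
(** * The reference element of a cell *)
Section CellBasis.
Variables (R : realType) (h : R) (k : nat).
Hypothesis h0 : 0 < h.
Local Notation C := R[i].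
Local Notation toC := (map_mx (real_complex R)).
Implicit Types (j : int) (c w : 'cV[C]_k.+1).

Definition cell_coord j : {poly R} := (h / 2)^-1 *: ('X - (node h j)%:P).

Lemma node_lr j : node_l h j < node_r h j.
Proof. by rewrite /node_l /node_r ltr_pM2r//; lra. Qed.

Lemma node_r_pred j : node_r h (j - 1) = node_l h j.
Proof. by rewrite /node_l /node_r intrB; congr (_ * _); lra. Qed.

Let h20 : h / 2 != 0. Proof. by rewrite gt_eqF// divr_gt0. Qed.

Lemma cell_coord_r j : (cell_coord j).[node_r h j] = 1.
Proof.
rewrite !hornerE /node_r /node.
by apply: (mulfI h20); rewrite mulrA mulfV// mul1r mulr1; lra.
Qed.

Lemma cell_coord_l j : (cell_coord j).[node_l h j] = - 1.
Proof.
rewrite !hornerE /node_l /node.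
by apply: (mulfI h20); rewrite mulrA mulfV// mul1r; lra.
Qed.

Lemma deriv_cell_coord j : (cell_coord j)^`() = ((h / 2)^-1)%:P.
Proof. by rewrite /cell_coord derivZ derivB derivX derivC subr0 alg_polyC. Qed.

Definition cell_prim j n : {poly R} := (h / 2 / n.+1%:R) *: cell_coord j ^+ n.+1.

Lemma deriv_cell_prim j n : (cell_prim j n)^`() = cell_coord j ^+ n.
Proof.
rewrite /cell_prim derivZ deriv_exp deriv_cell_coord /= mul_polyC.
rewrite scalerMnl scalerA -[RHS]scale1r; congr (_ *: _).
rewrite -mulr_natr; field.
by rewrite gt_eqF//= nat1r pnatr_eq0.
Qed.

(** The integral of the [n]-th basis function over a cell. *)
Definition moment n : R := h / 2 / n.+1%:R * (1 + (- 1) ^+ n).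

Lemma Rintegral_cell_coord j n :
  (\int[lebesgue_measure]_(x in cell h j) (cell_coord j ^+ n).[x])%R = moment n.
Proof.
rewrite (Rintegral_poly (node_lr j) (deriv_cell_prim j n)) /cell_prim !hornerZ !horner_exp.
by rewrite cell_coord_r cell_coord_l expr1n exprS /moment; ring.
Qed.

Lemma mass_mxE l m : mass_mx h k l m = moment (l + m).
Proof.
rewrite mxE -(Rintegral_cell_coord 0); congr Rintegral.
by apply/funext => x; rewrite exprD hornerM.
Qed.

Definition cell_poly j c : {poly C} := \sum_l c l 0 *: phiC h j l.

Definition coordC j : {poly C} := map_poly (real_complex R) (cell_coord j).

Lemma phiCE j l : phiC h j l = coordC j ^+ l.
Proof. exact: rmorphXn. Qed.

Lemma coordC_r j : (coordC j).[(node_r h j)%:C] = 1.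
Proof. by rewrite horner_map cell_coord_r rmorph1. Qed.

Lemma coordC_l j : (coordC j).[(node_l h j)%:C] = - 1.
Proof. by rewrite horner_map cell_coord_l rmorphN1. Qed.

(** Traces at the ends of a cell, differentiation and reflection about the node,
    in coordinates with respect to the monomial basis. *)
Definition ev_r : 'cV[C]_k.+1 := \col_l 1.
Definition ev_l : 'cV[C]_k.+1 := \col_l (- 1) ^+ l.
Definition dif : 'M[C]_k.+1 :=
  \matrix_(l, m) (if m == l.+1 :> nat then m%:R / (h / 2)%:C else 0).
Definition refl : 'M[C]_k.+1 := \matrix_(l, m) (if l == m then (- 1) ^+ l else 0).

Lemma evalE (a v : 'cV[C]_k.+1) : eval a v = \sum_l a l 0 * v l 0.
Proof. by rewrite /eval mxE; apply: eq_bigr => l _; rewrite mxE. Qed.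

Lemma cell_poly_r j c : (cell_poly j c).[(node_r h j)%:C] = eval ev_r c.
Proof.
rewrite horner_sum evalE; apply: eq_bigr => l _.
by rewrite hornerZ phiCE horner_exp coordC_r expr1n mxE mulrC.
Qed.

Lemma cell_poly_l j c : (cell_poly j c).[(node_l h j)%:C] = eval ev_l c.
Proof.
rewrite horner_sum evalE; apply: eq_bigr => l _.
by rewrite hornerZ phiCE horner_exp coordC_l mxE mulrC.
Qed.

Lemma deriv_coordC j : (coordC j)^`() = ((h / 2)%:C^-1)%:P.
Proof. by rewrite deriv_map deriv_cell_coord map_polyC /= fmorphV. Qed.

Lemma deriv_cell_poly j c : (cell_poly j c)^`() = cell_poly j (dif *m c).
Proof.
rewrite /cell_poly raddf_sum.
transitivity (\sum_(l < k.+1) \sum_m (dif l m * c m 0) *: phiC h j l); last first.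
  by apply: eq_bigr => l _; rewrite mxE scaler_suml.
rewrite exchange_big; apply: eq_bigr => m _ /=.
rewrite derivZ phiCE deriv_exp deriv_coordC mul_polyC scalerMnl scalerA.
case: m => -[|m] mk /=.
  rewrite mulr0n mulr0 scale0r big1// => l _.
  by rewrite mxE /= mul0r scale0r.
rewrite (bigD1 (Ordinal (ltnW mk))) //= big1 ?addr0 => [|l lm]; last first.
  have lm' : (m == l :> nat) = false by rewrite eq_sym; exact: negPf lm.
  by rewrite mxE /= eqSS lm' mul0r scale0r.
by rewrite mxE /= eqxx phiCE mulr_natl [_ * c _ _]mulrC.
Qed.

Lemma poly_prim (p : {poly C}) : exists P, P^`() = p.
Proof.
exists (\poly_(i < (size p).+1) (p`_i.-1 / i%:R)); apply/polyP => i.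
rewrite coef_deriv coef_poly ltnS; case: ltnP => [_|/leq_sizeP/(_ _ (leqnn i)) ->].
  by rewrite -[LHS]mulr_natr divfK// pnatr_eq0.
by rewrite mul0rn.
Qed.

Lemma intC_cell j (p P : {poly C}) : P^`() = p ->
  intC (cell h j) (fun x => p.[x%:C]) = P.[(node_r h j)%:C] - P.[(node_l h j)%:C].
Proof. exact: intC_poly (node_lr j). Qed.

Lemma intC_cell_sum j (I : finType) (p : I -> {poly C}) :
  intC (cell h j) (fun x => (\sum_i p i).[x%:C]) =
  \sum_i intC (cell h j) (fun x => (p i).[x%:C]).
Proof.
have /choice[P Pp] i := poly_prim (p i).
rewrite (@intC_cell _ _ (\sum_i P i)); last first.
  by rewrite raddf_sum; apply: eq_bigr => i _; exact: Pp.
rewrite !horner_sum -sumrB; apply: eq_bigr => i _.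
by rewrite (intC_cell _ (Pp i)).
Qed.

Lemma intC_cellZ j a (p : {poly C}) :
  intC (cell h j) (fun x => (a *: p).[x%:C]) =
  a * intC (cell h j) (fun x => p.[x%:C]).
Proof.
have [P Pp] := poly_prim p; rewrite (intC_cell _ Pp) (@intC_cell _ _ (a *: P)).
  by rewrite !hornerZ mulrBr.
by rewrite derivZ Pp.
Qed.

Lemma intC_coordC j n :
  intC (cell h j) (fun x => (coordC j ^+ n).[x%:C]) = (moment n)%:C.
Proof.
have H : (map_poly (real_complex R) (cell_prim j n))^`() = coordC j ^+ n.
  by rewrite deriv_map deriv_cell_prim rmorphXn.
rewrite (intC_cell _ H) !horner_map -rmorphB; congr (_%:C).
rewrite -(Rintegral_cell_coord j n).
by rewrite (Rintegral_poly (node_lr j) (deriv_cell_prim j n)).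
Qed.

(** The mass matrix does not depend on the cell. *)
Lemma intC_cell_poly j c w :
  intC (cell h j) (fun x => (cell_poly j c * cell_poly j w).[x%:C]) =
  (w^T *m massC h k *m c) 0 0.
Proof.
rewrite /cell_poly big_distrlr /= pair_big_dep /= intC_cell_sum.
rewrite mxE (eq_bigr (fun i => \sum_l w l 0 * (massC h k l i * c i 0))); last first.
  move=> i _; rewrite mxE mulr_suml; apply: eq_bigr => l _.
  by rewrite [w^T _ _]mxE mulrA.
rewrite pair_big_dep /=; apply: eq_bigr => -[l m] _ /=.
rewrite -scalerAl -scalerAr scalerA intC_cellZ !phiCE -exprD intC_coordC.
by rewrite mxE mass_mxE addnC; ring.
Qed.

Lemma intC_cellD j (p q : {poly C}) :
  intC (cell h j) (fun x => (p + q).[x%:C]) =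
  intC (cell h j) (fun x => p.[x%:C]) + intC (cell h j) (fun x => q.[x%:C]).
Proof.
have [P Pp] := poly_prim p; have [Q Qq] := poly_prim q.
rewrite (intC_cell _ Pp) (intC_cell _ Qq) (@intC_cell _ _ (P + Q)).
  by rewrite !hornerD; ring.
by rewrite derivD Pp Qq.
Qed.

Lemma mx_entryE (A : 'M[C]_k.+1) l m :
  ((delta_mx l 0 : 'cV_k.+1)^T *m A *m (delta_mx m 0 : 'cV_k.+1)) 0 0 = A l m.
Proof. by rewrite trmx_delta -rowE -colE !mxE. Qed.

Lemma eval_delta (a : 'cV[C]_k.+1) m : eval a (delta_mx m 0) = a m 0.
Proof. by rewrite /eval -colE !mxE. Qed.

Lemma mass_by_parts :
  massC h k *m dif + dif^T *m massC h k = ev_r *m ev_r^T - ev_l *m ev_l^T.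
Proof.
apply/matrixP => l m.
pose p c := cell_poly 0 c; pose e i : 'cV[C]_k.+1 := delta_mx i 0.
have H : intC (cell h 0) (fun x => (p (dif *m e m) * p (e l) + p (e m) * p (dif *m e l)).[x%:C])
    = eval ev_r (e m) * eval ev_r (e l) - eval ev_l (e m) * eval ev_l (e l).
  rewrite (@intC_cell _ _ (p (e m) * p (e l))); last by rewrite derivM !deriv_cell_poly.
  by rewrite !hornerM !cell_poly_r !cell_poly_l.
move: H; rewrite intC_cellD !intC_cell_poly trmx_mul !mulmxA.
rewrite -(mulmxA (e l)^T (massC h k) dif) -(mulmxA (e l)^T dif^T) !mx_entryE !eval_delta => H.
rewrite [LHS]mxE H [RHS]mxE; congr (_ + _); first by rewrite !mxE big_ord1 !mxE mulrC.
by rewrite !mxE big_ord1 !mxE mulrC.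
Qed.

Lemma cell_poly_comp j c : cell_poly j c = rVpoly c^T \Po coordC j.
Proof.
rewrite comp_polyE (big_ord_widen k.+1 (fun i => (rVpoly c^T)`_i *: coordC j ^+ i)).
  rewrite [RHS]big_mkcond; apply: eq_bigr => l _.
  case: ltnP => [_|/leq_sizeP/(_ _ (leqnn _))].
    by rewrite coef_rVpoly_ord mxE phiCE.
  by rewrite coef_rVpoly_ord mxE => ->; rewrite scale0r.
exact: size_poly.
Qed.

Lemma size_coordC j : size (coordC j) = 2%N.
Proof. by rewrite size_map_poly size_scale ?invr_eq0// size_XsubC. Qed.

Lemma cell_poly0 j c : cell_poly j c = 0 -> c = 0.
Proof.
move/eqP; rewrite cell_poly_comp comp_poly2_eq0 ?size_coordC// => /eqP c0.
by rewrite -[c]trmxK -[c^T]rVpolyK c0 linear0 trmx0.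
Qed.

(** Test functions are arbitrary polynomials of degree at most [k]; substituting
    the inverse of the affine cell coordinate gives their coefficients. *)
Lemma cell_poly_surj j (v : {poly C}) : (size v <= k.+1)%N -> exists w, v = cell_poly j w.
Proof.
move=> vk; pose A : {poly C} := (h / 2)%:C *: 'X + (node h j)%:C%:P.
have AX : A \Po coordC j = 'X.
  rewrite comp_polyD comp_polyZ comp_polyX comp_polyC /coordC /cell_coord.
  rewrite map_polyZ /= scalerA -rmorphM mulfV// rmorph1 scale1r rmorphB /=.
  by rewrite map_polyX map_polyC /= subrK.
have Asize : size A = 2%N.
  have a0 : (h / 2)%:C != 0 :> C by rewrite fmorph_eq0.
  by rewrite size_polyDl size_scale ?size_polyX// ltnS size_polyC_leq1.
exists (poly_rV (v \Po A))^T; rewrite cell_poly_comp trmxK poly_rV_K.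
  by rewrite -comp_polyA AX comp_polyXr.
by rewrite size_comp_poly2.
Qed.

(** Two derivatives lower the degree. *)
Lemma dif_eigen s (v : 'cV[C]_k.+1) : s != 0 -> dif *m (dif *m v) = s *: v -> v = 0.
Proof.
move=> s0 dv; apply: (cell_poly0 (j := 0)); apply/eqP/negPn/negP => p0.
have E : s *: cell_poly 0 v = (cell_poly 0 v)^`()^`().
  rewrite !deriv_cell_poly dv /cell_poly scaler_sumr; apply: eq_bigr => l _.
  by rewrite mxE scalerA.
have := lt_size_deriv p0; rewrite -[X in (_ < X)%N](size_scale _ s0) E ltnNge => /negP; apply.
have [->|d0] := eqVneq (cell_poly 0 v)^`() 0; first by rewrite deriv0.
exact: ltnW (lt_size_deriv d0).
Qed.

Lemma dif_ker (v : 'cV[C]_k.+1) : dif *m v = 0 -> exists a : C, v = a *: e0 R k.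
Proof.
move=> dv; have p0 : (cell_poly 0 v)^`() = 0.
  by rewrite deriv_cell_poly dv /cell_poly big1// => l _; rewrite mxE scale0r.
have : (size (cell_poly 0 v) <= 1)%N.
  apply/leq_sizeP => -[//|i] _; have := congr1 (fun p : {poly C} => p`_i) p0.
  by rewrite coef_deriv coef0 => /eqP; rewrite mulrn_eq0 /= => /eqP.
rewrite cell_poly_comp size_comp_poly2 ?size_coordC// => /leq_sizeP vl.
exists (v 0 0); apply/colP => l; rewrite !mxE eqxx andbT.
case: (unliftP 0 l) => [l' ->|->]; last by rewrite eqxx mulr1.
have := coef_rVpoly_ord v^T (lift 0 l'); rewrite vl// mxE => <-.
by rewrite mulr0.
Qed.

Lemma dif_e0 : dif *m e0 R k = 0.
Proof.
apply/colP => l; rewrite -colE !mxE /=.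
by [].
Qed.

Lemma reflK : refl *m refl = 1%:M.
Proof.
apply/matrixP => l m; rewrite mxE (bigD1 l)//= big1 => [|i il]; last first.
  by rewrite mxE eq_sym (negPf il) mul0r.
rewrite !mxE eqxx addr0; case: eqVneq => [->|_]; last by rewrite mulr0.
by rewrite -expr2 sqrr_sign.
Qed.

Let mul_refl (A : 'M[C]_k.+1) l m : (refl *m A) l m = (- 1) ^+ l * A l m.
Proof.
rewrite mxE (bigD1 l)//= big1 => [|i il]; last by rewrite mxE eq_sym (negPf il) mul0r.
by rewrite mxE eqxx addr0.
Qed.

Let mulr_refl (A : 'M[C]_k.+1) l m : (A *m refl) l m = (- 1) ^+ m * A l m.
Proof.
rewrite mxE (bigD1 m)//= big1 => [|i il]; last by rewrite [refl _ _]mxE (negPf il) mulr0.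
by rewrite [refl _ _]mxE eqxx addr0 mulrC.
Qed.

Lemma refl_tr : refl^T = refl.
Proof. by apply/matrixP => l m; rewrite !mxE eq_sym; case: eqVneq => // ->. Qed.

Lemma refl_mass : refl *m massC h k = massC h k *m refl.
Proof.
apply/matrixP => l m; rewrite mul_refl mulr_refl mxE mass_mxE /moment.
have [lm|lm] := boolP (odd (l + m)).
  have -> : (- 1) ^+ (l + m) = - 1 :> R by rewrite -signr_odd lm.
  by rewrite subrr mulr0 rmorph0 !mulr0.
congr (_ * _); rewrite -[LHS]signr_odd -[RHS]signr_odd; congr (_ ^+ _).
by move: lm; rewrite oddD; case: (odd l); case: (odd m).
Qed.

Lemma refl_dif : refl *m dif = - (dif *m refl).
Proof.
apply/matrixP => l m; rewrite [RHS]mxE mul_refl mulr_refl [dif l m]mxE.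
case: eqP => [->|_]; last by rewrite !mulr0 oppr0.
by rewrite exprS; ring.
Qed.

Lemma refl_ev_r : refl *m ev_r = ev_l.
Proof.
apply/colP => l; rewrite !mxE (bigD1 l)//= big1 => [|i il].
  by rewrite !mxE eqxx mulr1 addr0.
by rewrite mxE eq_sym (negPf il) mul0r.
Qed.

Lemma refl_e0 : refl *m e0 R k = e0 R k.
Proof.
apply/colP => l; rewrite -colE !mxE.
by case: (l =P 0) => [->|//]; rewrite eqxx.
Qed.

Lemma mass_sym : (massC h k)^T = massC h k.
Proof. by apply/matrixP => l m; rewrite mxE [LHS]mxE [RHS]mxE !mass_mxE addnC. Qed.

(** A polynomial whose square integrates to zero over a cell vanishes, since
    the primitive of the square is then constant. *)
Lemma mass_real_pos (x : 'cV[R]_k.+1) :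
  0 <= (x^T *m mass_mx h k *m x) 0 0 /\ ((x^T *m mass_mx h k *m x) 0 0 = 0 -> x = 0).
Proof.
pose p : {poly R} := \sum_l x l 0 *: phi h 0 l.
pose P : {poly R} := \sum_l \sum_m (x l 0 * x m 0) *: cell_prim 0 (l + m).
have Pp : P^`() = p ^+ 2.
  rewrite expr2 /p big_distrlr raddf_sum; apply: eq_bigr => l _.
  rewrite raddf_sum; apply: eq_bigr => m _ /=.
  by rewrite derivZ deriv_cell_prim -scalerAl -scalerAr scalerA exprD.
have E : (x^T *m mass_mx h k *m x) 0 0 = P.[node_r h 0] - P.[node_l h 0].
  rewrite mxE /P !horner_sum -sumrB (eq_bigr (fun i => \sum_l x l 0 * (mass_mx h k l i * x i 0))).
    rewrite exchange_big; apply: eq_bigr => l _.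
    rewrite !horner_sum -sumrB; apply: eq_bigr => m _.
    rewrite mass_mxE /cell_prim !hornerZ !horner_exp cell_coord_r cell_coord_l.
    by rewrite /moment expr1n exprS; ring.
  move=> i _; rewrite mxE mulr_suml; apply: eq_bigr => l _.
  by rewrite [x^T _ _]mxE mulrA.
have sq y : 0 <= (p ^+ 2).[y] by rewrite horner_exp sqr_ge0.
rewrite E; split.
  rewrite -(Rintegral_poly (node_lr 0) Pp).
  by apply: Rintegral_ge0.
move=> /eqP; rewrite subr_eq0 => /eqP Prl.
have p0 : p = 0.
  have /eqP : p ^+ 2 = 0 by apply: (poly_monotone_eq (node_lr 0) Pp sq); rewrite Prl.
  by rewrite expf_eq0 => /eqP.
have : cell_poly 0 (toC x) = 0.
  rewrite (_ : cell_poly 0 (toC x) = map_poly (real_complex R) p).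
    by rewrite p0 rmorph0.
  rewrite rmorph_sum; apply: eq_bigr => l _.
  by rewrite mxE /= map_polyZ.
by move/cell_poly0/eqP; rewrite map_mx_eq0 => /eqP.
Qed.

End CellBasis.
Section LDGBlocks.
Variables (R : realType) (h : R) (k : nat).
Hypothesis h0 : 0 < h.
Local Notation C := R[i].
Local Notation mu := (@lebesgue_measure R).
Implicit Types (j : int) (c : int -> 'cV[C]_k.+1).

Lemma poly_restrict_Lfun (p : {poly R}) (a b : R) :
  (horner p \_ `]a, b[) \in Lfun mu 2%:E.
Proof.
rewrite inE; apply/andP; split; rewrite inE /=.
  apply: (iffLR (measurable_restrictT (horner p) (measurable_itv `]a, b[))).
  exact: measurable_poly.
rewrite /finite_norm unlock /=.
apply: poweR_lty.
have pint : mu.-integrable `]a, b[ (EFin \o horner (p ^+ 2)).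
  by apply: integrableS (poly_integrable (p ^+ 2) a b) => //; exact: subset_itv_oo_cc.
have /integrableP[_] := pint; rewrite integral_mkcond.
congr (_ < _)%E; apply: eq_integral => x _.
rewrite !patchE; case: ifPn => _ /=.
  by rewrite horner_exp normrX powR_mulrn.
by rewrite normr0 powR0.
Qed.

Lemma toC_real m p (A : 'M[R]_(m, p)) : real_mx (map_mx (real_complex R) A).
Proof. by apply/matrixP => i j; rewrite !mxE; exact: conjc_real. Qed.

Lemma signC_real i : ((- 1) ^+ i : C)^*%R = (- 1) ^+ i.
Proof. by rewrite rmorphXn rmorphN1. Qed.

Lemma ev_l_real : real_mx (ev_l R k).
Proof. by apply/matrixP => i j; rewrite !mxE signC_real. Qed.

Lemma ev_r_real : real_mx (ev_r R k).
Proof. by apply/matrixP => i j; rewrite !mxE conjC1. Qed.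

Lemma refl_real : real_mx (refl R k).
Proof.
by apply/matrixP => i j; rewrite !mxE; case: ifP; rewrite ?signC_real ?conjC0.
Qed.

Lemma dif_real : real_mx (dif h k).
Proof.
apply/matrixP => i j; rewrite !mxE; case: ifP => _; last by rewrite conjC0.
rewrite fmorph_div rmorph_nat; congr (_ / _); exact: conjc_real.
Qed.

Lemma e0_real : real_mx (e0 R k).
Proof. by apply/matrixP => i j; rewrite !mxE rmorph_nat. Qed.

(** The Hermitian form of a real symmetric matrix is the sum of the values of its
    quadratic form at the real and imaginary parts. *)
Lemma mass_pos (v : 'cV[C]_k.+1) : v != 0 -> 0 < (v^t* *m massC h k *m v) 0 0.
Proof.
move=> v0; pose x := map_mx (@complex.Re R) v; pose y := map_mx (@complex.Im R) v.
pose b (u w : 'cV[R]_k.+1) := (u^T *m mass_mx h k *m w) 0 0.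
have bE u w : b u w = \sum_i \sum_j u j 0 * mass_mx h k j i * w i 0.
  rewrite /b mxE; apply: eq_bigr => i _; rewrite mxE mulr_suml; apply: eq_bigr => j _.
  by rewrite mxE.
have bsym u w : b u w = b w u.
  rewrite !bE exchange_big; apply: eq_bigr => i _; apply: eq_bigr => j _.
  by rewrite !(mass_mxE h0) addnC; ring.
have -> : (v^t* *m massC h k *m v) 0 0 = (b x x + b y y)%:C.
  rewrite mxE; transitivity ((b x x + b y y) +i* (b x y - b y x)); last first.
    by rewrite bsym subrr.
  rewrite !bE.
  rewrite (eq_bigr (fun i => \sum_j v^t* 0 j * massC h k j i * v i 0)); last first.
    by move=> i _; rewrite mxE mulr_suml.
  apply: complex_ext; rewrite [RHS]/=.
    rewrite raddf_sum -big_split; apply: eq_bigr => i _.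
    rewrite raddf_sum -big_split; apply: eq_bigr => j _ /=.
    by rewrite !mxE; case: (v j 0) => vr vi; case: (v i 0) => wr wi /=; ring.
  rewrite raddf_sum -sumrB; apply: eq_bigr => i _.
  rewrite raddf_sum -sumrB; apply: eq_bigr => j _ /=.
  by rewrite !mxE; case: (v j 0) => vr vi; case: (v i 0) => wr wi /=; ring.
have [xx x0] := mass_real_pos h0 x; have [yy y0] := mass_real_pos h0 y.
rewrite ltcR lt_def addr_ge0// andbT; apply: contra v0 => /eqP xy.
have xx0 : b x x = 0 by apply/eqP; rewrite eq_le xx andbT -xy lerDl.
have yy0 : b y y = 0 by apply/eqP; rewrite eq_le yy andbT -xy lerDr.
apply/eqP/colP => i; apply: complex_ext; rewrite mxE /=.
  by have := congr1 (fun u => fun_of_matrix u i 0) (x0 xx0); rewrite !mxE.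
by have := congr1 (fun u => fun_of_matrix u i 0) (y0 yy0); rewrite !mxE.
Qed.

Lemma eval_r_e0 : eval (ev_r R k) (e0 R k) = 1.
Proof. by rewrite /e0 eval_delta mxE. Qed.

Definition cell_element : element R k.+1 :=
  @Element R k.+1 (massC h k) (dif h k) (refl R k) (ev_l R k) (ev_r R k) (e0 R k)
    (toC_real (mass_mx h k)) dif_real refl_real ev_l_real ev_r_real e0_real
    (mass_sym k h0) mass_pos (mass_by_parts k h0)
    (fun z v => @dif_eigen R h k h0 z v) (dif_e0 h k) (fun v => @dif_ker R h k h0 v)
    eval_r_e0 (reflK R k) (refl_tr R k) (refl_mass k h0) (refl_dif h k)
    (refl_ev_r R k) (refl_e0 R k).

End LDGBlocks.
(** * The stiffness blocks of the scheme *)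
Section LDGScheme.
Variables (R : realType) (h : R) (k : nat).
Hypothesis h0 : 0 < h.
Local Notation C := R[i].
Local Notation mu := (@lebesgue_measure R).
Implicit Types (j : int) (c e : int -> 'cV[C]_k.+1) (u q : R -> C).
Local Notation M := (massC h k).
Local Notation dm := (dif h k).
Local Notation l := (ev_l R k).
Local Notation r := (ev_r R k).

Lemma cell_inj i j (x : R) : cell h i x -> cell h j x -> i = j.
Proof.
have le a b : cell h a x -> cell h b x -> a <= b.
  move=> /andP[ax _] /andP[_ xb]; have := lt_trans ax xb.
  rewrite /node_l /node_r ltr_pM2r// => H.
  have : (a%:~R : R) < (b + 1)%:~R by rewrite intrD; lra.
  by rewrite ltr_int ltzD1.
by move=> ix jx; apply/eqP; rewrite eq_le !le.
Qed.

Lemma eq_intC (D : set R) (f g : R -> C) : (forall x, D x -> f x = g x) ->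
  intC D f = intC D g.
Proof.
by move=> fg; rewrite /intC; congr (_ +i* _); apply: eq_Rintegral => x;
  rewrite inE => /fg ->.
Qed.

(** Two cells carry both a function supported on the cell 0 and its auxiliary
    variable. *)
Definition two_cells c (x : R) : C :=
  (if x \in cell h 0 then (cell_poly h 0 (c 0)).[x%:C] else 0)
  + (if x \in cell h 1 then (cell_poly h 1 (c 1)).[x%:C] else 0).

Lemma L2_restrict j (p : {poly C}) :
  L2 (fun x => if x \in cell h j then p.[x%:C] else 0).
Proof.
have cE : cell h j = `]node_l h j, node_r h j[%classic by rewrite set_itvoo.
split.
  have -> : (fun x => complex.Re (if x \in cell h j then p.[x%:C] else 0)) =
      horner (Re_poly p) \_ (`]node_l h j, node_r h j[%classic).
    by apply/funext => x; rewrite patchE -cE; case: ifP => _ //=; rewrite horner_ReIm.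
  exact: poly_restrict_Lfun.
have -> : (fun x => complex.Im (if x \in cell h j then p.[x%:C] else 0)) =
    horner (Im_poly p) \_ (`]node_l h j, node_r h j[%classic).
  by apply/funext => x; rewrite patchE -cE; case: ifP => _ //=; rewrite horner_ReIm.
exact: poly_restrict_Lfun.
Qed.

Lemma L2D (f g : R -> C) : L2 f -> L2 g -> L2 (fun x => f x + g x).
Proof.
have p1 : (1 <= 2%:E :> \bar R)%E by rewrite lee_fin ler1n.
move=> [fr fi] [gr gi]; split.
  have -> : (fun x => complex.Re (f x + g x)) =
      (fun x => complex.Re (f x)) + (fun x => complex.Re (g x)).
    by apply/funext => x; rewrite fctE; exact: raddfD.
  exact: (Lfun_addr_closed mu p1).2.
have -> : (fun x => complex.Im (f x + g x)) =
    (fun x => complex.Im (f x)) + (fun x => complex.Im (g x)).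
  by apply/funext => x; rewrite fctE; exact: raddfD.
exact: (Lfun_addr_closed mu p1).2.
Qed.

Definition two_cell_support c : Prop := forall j, j != 0 -> j != 1 -> c j = 0.

Lemma cell_poly_0 j : cell_poly h j (0 : 'cV[C]_k.+1) = 0.
Proof. by rewrite /cell_poly big1// => i _; rewrite mxE scale0r. Qed.

Lemma two_cellsE c j x : two_cell_support c -> cell h j x ->
  two_cells c x = (cell_poly h j (c j)).[x%:C].
Proof.
move=> cs jx.
have out i : i != j -> (x \in cell h i) = false.
  by move=> ij; apply/negP; rewrite inE => ix; move: ij; rewrite (cell_inj ix jx) eqxx.
have on : x \in cell h j by rewrite inE.
rewrite /two_cells; have [j0|j0] := eqVneq j 0.
  by rewrite (out 1) ?j0// addr0 -j0 on.
have [j1|j1] := eqVneq j 1.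
  by rewrite (out 0) ?j1// add0r -j1 on.
by rewrite !out 1?eq_sym// addr0 cs// cell_poly_0 horner0.
Qed.

Lemma Vh_two_cells c : two_cell_support c -> Vh h k (two_cells c).
Proof.
move=> cs; split; first by apply: L2D; exact: L2_restrict.
move=> j; exists (cell_poly h j (c j)); last by move=> x; exact: two_cellsE.
rewrite /Pk /= cell_poly_comp size_comp_poly2 ?size_coordC//.
exact: size_poly.
Qed.

Lemma two_cells_coefficients c : two_cell_support c -> coefficients h (two_cells c) c.
Proof.
move=> cs j x jx; rewrite (two_cellsE cs jx) horner_sum.
by apply: eq_bigr => i _; rewrite hornerZ.
Qed.

Section PiecewisePoly.
Variables (u : R -> C) (p : int -> {poly C}).
Hypothesis up : forall j x, cell h j x -> u x = (p j).[x%:C].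

Lemma trace_left_cell j : trace_left u (node_r h j) = (p j).[(node_r h j)%:C].
Proof.
apply: limC_unique; first by apply: cvg_within.
near=> x; apply: up; rewrite /cell /=; apply/andP; split; near: x.
  by apply: nbhs_left_gt; exact: node_lr.
exact: nbhs_left_lt.
Unshelve. all: by end_near.
Qed.

Lemma trace_right_cell j : trace_right u (node_l h j) = (p j).[(node_l h j)%:C].
Proof.
apply: limC_unique; first by apply: cvg_within.
near=> x; apply: up; rewrite /cell /=; apply/andP; split; near: x.
  exact: nbhs_right_gt.
by apply: nbhs_right_lt; exact: node_lr.
Unshelve. all: by end_near.
Qed.

End PiecewisePoly.

End LDGScheme.
Section LDGMatrices.
Variables (R : realType) (h : R) (k : nat).
Hypothesis h0 : 0 < h.
Local Notation C := R[i].
Local Notation cj := (@Num.conj C).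
Local Notation toC := (map_mx (real_complex R)).
Implicit Types (j : int) (c e : int -> 'cV[C]_k.+1) (u q : R -> C).
Local Notation M := (massC h k).
Local Notation dm := (dif h k).
Local Notation l := (ev_l R k).
Local Notation r := (ev_r R k).
Local Notation E := (cell_element k h0).

Definition form (A : 'M[C]_k.+1) (x y : 'cV[C]_k.+1) : C := (x^T *m A *m y) 0 0.

Lemma formD A B x y : form (A + B) x y = form A x y + form B x y.
Proof. by rewrite /form mulmxDr mulmxDl mxE. Qed.

Lemma formN A x y : form (- A) x y = - form A x y.
Proof. by rewrite /form mulmxN mulNmx mxE. Qed.

Lemma form_rank1 (a b x y : 'cV[C]_k.+1) : form (a *m b^T) x y = eval a x * eval b y.
Proof.
rewrite /form mulmxA -mulmxA [LHS]mxE big_ord1; congr (_ * _).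
by rewrite -/(eval x a) !evalE; apply: eq_bigr => i _; rewrite mulrC.
Qed.

Lemma form_mull (A B : 'M[C]_k.+1) x y : form A (B *m x) y = form (B^T *m A) x y.
Proof. by rewrite /form trmx_mul -(mulmxA _ B^T). Qed.

Lemma form_delta (A : 'M[C]_k.+1) i y : form A (delta_mx i 0) y = (A *m y) i 0.
Proof. by rewrite /form trmx_delta -rowE -row_mul mxE. Qed.

(** The equation of the auxiliary variable couples a cell with the preceding one,
    the residual couples it with the following one. *)
Definition aux0 : 'M[C]_k.+1 := M *m dm + l *m l^T.
Definition aux1 : 'M[C]_k.+1 := - (l *m r^T).
Definition res0 : 'M[C]_k.+1 := - (M *m dm) + r *m r^T.
Definition res1 : 'M[C]_k.+1 := - (r *m l^T).

Lemma dif_mass : dm^T *m M = r *m r^T - l *m l^T - M *m dm.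
Proof. by rewrite -(mass_by_parts k h0) addrC addKr. Qed.

Section Scheme.
Variables (u q : R -> C) (c e : int -> 'cV[C]_k.+1).
Hypothesis uc : forall j x, cell h j x -> u x = (cell_poly h j (c j)).[x%:C].
Hypothesis qe : forall j x, cell h j x -> q x = (cell_poly h j (e j)).[x%:C].

(** On each cell the weak equation reads [M e_j = - dm^T M c_j] plus boundary
    terms; integration by parts moves the derivative onto [c_j]. *)
Lemma ldg_auxiliary_mx :
  (forall j, M *m e j = aux0 *m c j + aux1 *m c (j - 1)) -> ldg_auxiliary h k u q.
Proof.
move=> ec j v /(cell_poly_surj h0 j)[w ->].
have -> : trace_left u (node_l h j) = eval r (c (j - 1)).
  by rewrite -node_r_pred (trace_left_cell h0 uc) (cell_poly_r h0).
rewrite (trace_left_cell h0 uc j) !(cell_poly_r h0) !(cell_poly_l h0).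
rewrite (@eq_intC _ _ _ (fun x => (cell_poly h j (e j) * cell_poly h j w).[x%:C])); last first.
  by move=> x jx; rewrite (qe jx) hornerM.
rewrite (@eq_intC _ _ (fun x => u x * _) (fun x => (cell_poly h j (c j) * cell_poly h j (dm *m w)).[x%:C])); last first.
  by move=> x jx; rewrite (uc jx) deriv_cell_poly hornerM.
rewrite !(intC_cell_poly h0) -/(form _ _ _) -/(form M (dm *m w) _) form_mull dif_mass.
have -> : form M w (e j) = form aux0 w (c j) + form aux1 w (c (j - 1)).
  by rewrite /form -mulmxA ec mulmxDr mxE !mulmxA.
rewrite /aux0 /aux1 !formD !formN !form_rank1; ring.
Qed.

Lemma ldg_residual_mx j (i : 'I_k.+1) :
  ldg_residual h q j i = (res0 *m e j + res1 *m e (j + 1)) i 0.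
Proof.
have phiE : phiC h j i = cell_poly h j (delta_mx i 0 : 'cV[C]_k.+1).
  rewrite /cell_poly (bigD1 i)//= big1 => [|m mi]; last by rewrite mxE (negPf mi) scale0r.
  by rewrite mxE !eqxx scale1r addr0.
rewrite /ldg_residual phiE.
have -> : trace_right q (node_r h j) = eval l (e (j + 1)).
  have nE : node_r h j = node_l h (j + 1) by rewrite -node_r_pred addrK.
  by rewrite nE (trace_right_cell h0 qe) (cell_poly_l h0).
rewrite (trace_right_cell h0 qe j).
rewrite (@eq_intC _ _ _ (fun x => (cell_poly h j (e j) * cell_poly h j (dm *m (delta_mx i 0 : 'cV[C]_k.+1))).[x%:C])); last first.
  by move=> x jx; rewrite (qe jx) deriv_cell_poly hornerM.
rewrite (intC_cell_poly h0) -/(form M (dm *m _) _) form_mull dif_mass.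
rewrite !(cell_poly_r h0) !(cell_poly_l h0).
rewrite [RHS]mxE -!form_delta /res0 /res1 !formD !formN !form_rank1; ring.
Qed.

End Scheme.

(** A function supported on one cell has its auxiliary variable supported on this
    cell and the next one, and its residual on three cells, one for each block. *)
Theorem stiffness_blocksE (Km K0 Kp : 'M[R]_k.+1) : stiffness_blocks h Km K0 Kp ->
  [/\ toC K0 = res0 *m invmx M *m aux0 + res1 *m invmx M *m aux1,
      toC Km = res0 *m invmx M *m aux1 & toC Kp = res1 *m invmx M *m aux0].
Proof.
move=> Kblocks.
have MU : M \in unitmx := el_M_unit E.
have test (a : 'cV[C]_k.+1) : [/\
    toC K0 *m a = (res0 *m invmx M *m aux0 + res1 *m invmx M *m aux1) *m a,
    toC Km *m a = res0 *m invmx M *m aux1 *m a &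
    toC Kp *m a = res1 *m invmx M *m aux0 *m a].
  pose c j : 'cV[C]_k.+1 := if j == 0 then a else 0.
  pose e j : 'cV[C]_k.+1 := if j == 0 then invmx M *m (aux0 *m a)
    else if j == 1 then invmx M *m (aux1 *m a) else 0.
  have cs : two_cell_support c by move=> j /negPf j0 _; rewrite /c j0.
  have es : two_cell_support e by move=> j /negPf j0 /negPf j1; rewrite /e j0 j1.
  have ec j : M *m e j = aux0 *m c j + aux1 *m c (j - 1).
    rewrite /e /c subr_eq0; have [->|j0] := eqVneq j 0.
      by rewrite (mulKVmx MU) (_ : (0 == 1 :> int) = false)// mulmx0 addr0.
    case: eqVneq => [_|_]; first by rewrite (mulKVmx MU) mulmx0 add0r.
    by rewrite !mulmx0 addr0.
  have H j (i : 'I_k.+1) := Kblocks _ _ _ (Vh_two_cells h0 cs) (Vh_two_cells h0 es)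
    (ldg_auxiliary_mx (fun j x => two_cellsE h0 cs) (fun j x => two_cellsE h0 es) ec)
    (two_cells_coefficients h0 cs) j i.
  have {}H j : toC Km *m c (j - 1) + toC K0 *m c j + toC Kp *m c (j + 1) =
      res0 *m e j + res1 *m e (j + 1).
    apply/colP => i; rewrite H (ldg_residual_mx (fun j x => two_cellsE h0 es)).
    by [].
  split.
  - have := H 0; rewrite /c /e /= !mulmx0 add0r addr0 => ->.
    by rewrite mulmxDl -!mulmxA.
  - have := H 1; rewrite /c /e /= !mulmx0 !addr0 => ->.
    by rewrite -!mulmxA.
  - have := H (- 1); rewrite /c /e /= !mulmx0 !add0r => ->.
    by rewrite -!mulmxA.
have mx_ext (A B : 'M[C]_k.+1) : (forall a : 'cV[C]_k.+1, A *m a = B *m a) -> A = B.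
  move=> AB; apply/matrixP => i j; have := AB (delta_mx j 0).
  by move/(congr1 (fun x => fun_of_matrix x i 0)); rewrite -!colE !mxE.
by split; apply: mx_ext => a; have [] := test a.
Qed.

Lemma expi_opp (t : R) : expi (- t) = cj (expi t).
Proof. by rewrite /expi cosN sinN. Qed.

Lemma expi_unit (t : R) : expi t * cj (expi t) = 1.
Proof.
apply: complex_ext; rewrite /=; last by ring.
by rewrite mulrN opprK -!expr2 cos2Dsin2.
Qed.

Lemma phase_expand (A0 A1 V B0 B1 : 'M[C]_k.+1) (z z' : C) : z' * z = 1 ->
  (A0 + z' *: A1) *m V *m (B0 + z *: B1) =
  A0 *m V *m B0 + A1 *m V *m B1 + z *: (A0 *m V *m B1) + z' *: (A1 *m V *m B0).
Proof.
move=> zz; rewrite !mulmxDl !mulmxDr -!scalemxAl -!scalemxAr scalerA zz scale1r.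
move: (A0 *m V *m B0) (A1 *m V *m B1) (A0 *m V *m B1) (A1 *m V *m B0) => X0 X1 X2 X3.
by apply/matrixP => i j; rewrite !mxE; ring.
Qed.

Theorem symbol_mxE (Km K0 Kp : 'M[R]_k.+1) xi : stiffness_blocks h Km K0 Kp ->
  symbol_mx h Km K0 Kp xi = bloch_mx E (expi (- (xi * h))).
Proof.
move=> /stiffness_blocksE[K0E KmE KpE].
rewrite /symbol_mx K0E KmE KpE /bloch_mx bloch_dmx_herm.
have -> : expi (xi * h) = cj (expi (- (xi * h))) by rewrite -expi_opp opprK.
have zz := expi_unit (- (xi * h)); set z := expi _ in zz *.
have -> : bloch_dmx E z = aux0 + z *: aux1.
  by rewrite /bloch_dmx /aux0 /aux1 mulmxBr -scalemxAr scalerN addrA.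
have -> : - (el_M E *m el_d E) + el_r E *m ((el_r E)^T - cj z *: (el_l E)^T) =
    res0 + cj z *: res1.
  by rewrite /res0 /res1 mulmxBr -scalemxAr scalerN addrA.
by rewrite phase_expand// mulrC.
Qed.

End LDGMatrices.
(** * Eigenvectors of the bands and the principal branch *)
Section Frame.
Variables (R : realType) (h : R) (k : nat).
Hypothesis h0 : 0 < h.
Local Notation C := R[i].
Local Notation cj := (@Num.conj C).
Local Notation M := (massC h k).
Local Notation E := (cell_element k h0).
Local Notation l := (ev_l R k).
Local Notation r := (ev_r R k).

Definition phase (t : R) : C := expi (- h * t).

Lemma phase_analytic x : real_analytic_atC phase x.
Proof. exact: analyticC_expi. Qed.

Lemma phase_unit t : phase t * cj (phase t) = 1.
Proof. exact: expi_unit. Qed.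

Lemma phase0 : phase 0 = 1.
Proof. by rewrite /phase mulr0 /expi cos0 sin0. Qed.

Lemma phaseN t : phase (- t) = cj (phase t).
Proof. by rewrite /phase mulrN expi_opp. Qed.

Variable sig : R -> seq R.
Hypothesis sig_sorted : forall t, sorted <%R (sig t).
Hypothesis sig_size : forall t, size (sig t) = k.+1.
Hypothesis sigP : forall t s, s \in sig t <->
  exists v q, v != 0 /\ bloch_pair E (phase t) s v q.
Hypothesis sig_an : forall i x, (i < k.+1)%N ->
  real_analytic_at (fun t => nth 0 (sig t) i) x.

(** The functional that normalizes the waves of a band: the trace for the
    lowest band, the jump for the others, whose eigenvalues never vanish. *)
Definition band_functional (i : 'I_k.+1) (t : R) : 'rV[C]_k.+1 :=
  if i == 0 then r^T else l^T - phase t *: r^T.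

Lemma analytic_band_functional i x : analytic_mx (band_functional i) x.
Proof.
rewrite /band_functional; case: (i == 0); first exact: analytic_mx_cst.
have H : analytic_mx (fun t => l^T + (- phase t) *: r^T) x.
  apply: analytic_mxD; first exact: analytic_mx_cst.
  apply: analytic_mxZ; last exact: analytic_mx_cst.
  have := analyticCM (analyticC_cst (-1) x) (phase_analytic x).
  by congr real_analytic_atC; apply/funext => t; rewrite mulN1r.
move=> a b; have := H a b.
by congr real_analytic_atC; apply/funext => t; rewrite scaleNr.
Qed.

Lemma band_eigenvectors (i : 'I_k.+1) : exists v : R -> 'cV[C]_k.+1,
  [/\ forall x, analytic_mx v x, forall t, ip E (v t) (v t) = 1, forall t, v t != 0
    & forall t, exists q, bloch_pair E (phase t) (nth 0 (sig t) i) (v t) q].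
Proof.
pose s t := nth 0 (sig t) i.
pose B t : 'M[C]_k.+1 := bloch_mx E (phase t) - (s t)%:C *: M.
have BP t (v : 'cV[C]_k.+1) : B t *m v = 0 <-> exists q, bloch_pair E (phase t) (s t) v q.
  rewrite -bloch_mxP /B mulmxBl -scalemxAl.
  by split=> [/eqP|->]; [rewrite subr_eq0 => /eqP|rewrite subrr].
have Ban x : analytic_mx B x.
  have H : analytic_mx (fun t => bloch_mx E (phase t) + (- s t)%:C *: M) x.
    apply: analytic_mxD; first exact: (analytic_bloch_mx E phase_analytic).
    apply: analytic_mxZ; last exact: analytic_mx_cst.
    by apply/analyticC_real/analyticN/sig_an.
  move=> a b; have := H a b.
  by congr real_analytic_atC; apply/funext => t; rewrite /B rmorphN scaleNr.
have Bh t : (B t)^t* = B t.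
  rewrite /B linearB linearZ map_mxB map_mxZ bloch_mx_herm.
  congr (_ - _ *: _); first exact: conjc_real.
  by rewrite (real_herm (el_M_real E)) (el_M_sym E).
have Bker t : exists v : 'cV[C]_k.+1, [/\ v != 0, B t *m v = 0 &
    forall w : 'cV[C]_k.+1, B t *m w = 0 -> exists c, w = c *: v].
  have /sigP[v [q [v0 vq]]] := band_mem sig_size t (ltn_ord i).
  exists v; split=> //; first by apply/BP; exists q.
  by move=> w /BP[p wp]; have [c [wE _]] := bloch_simple (phase_unit t) v0 vq wp; exists c.
have fker t (v : 'cV[C]_k.+1) : v != 0 -> B t *m v = 0 -> (band_functional i t *m v) 0 0 != 0.
  move=> v0 /BP[q vq]; rewrite /band_functional; case: (eqVneq i 0) => i0.
    rewrite /s i0 in vq.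
    exact: (lowest_band_trace phase_unit phase0 sig_sorted sig_size sigP sig_an (ltn0Sn k) v0 vq).
  have -> : ((l^T - phase t *: r^T) *m v) 0 0 = jump_l E (phase t) v.
    by rewrite mulmxBl -scalemxAl mxE [X in _ + X]mxE [X in - X]mxE.
  apply: contra v0 => /eqP jv; apply/eqP.
  apply: (bloch_jump_eq0 (phase_unit t) vq _ jv); rewrite gt_eqF//.
  apply: (band_pos sig_sorted sig_size sigP (ltn0Sn k)).
  by rewrite lt0n i0 ltn_ord.
have [u [uan uP]] := analytic_kernel Ban (analytic_band_functional i) Bh Bker fker.
have u0 t : u t != 0 by case: (uP t).
have [v [van vv vu]] := analytic_normalized E uan u0.
exists v; split=> // t; have [c c0 ->] := vu t.
  by rewrite scaler_eq0 negb_or c0 u0.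
by apply/BP; rewrite -scalemxAr (uP t).2 scaler0.
Qed.

Lemma mass_1_1 : ip E (e0 R k) (e0 R k) = h%:C.
Proof.
rewrite /ip (real_herm (el_1_real E)) /= /e0 mx_entryE mxE (mass_mxE h0) /moment expr0 divr1.
by congr (_%:C); lra.
Qed.

Definition normsq (a : C) : R := complex.Re a ^+ 2 + complex.Im a ^+ 2.

Lemma normsqE (a : C) : a * cj a = (normsq a)%:C.
Proof. by case: a => x y; apply: complex_ext => /=; rewrite /normsq /=; ring. Qed.

Lemma normsqM (a b : C) : normsq (a * b) = normsq a * normsq b.
Proof. by case: a b => x y [x' y']; rewrite /normsq /=; ring. Qed.

Lemma normsq_entire (f : R -> C) : (forall x, real_analytic_atC f x) ->
  entire (fun t => normsq (f t)).
Proof. by move=> fan x; have [? ?] := fan x; apply: analyticD; apply: analyticX. Qed.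

(** With the wave [v] of the lowest band, [bloch_mean] reads
    [sigma |mean v|^2 = (2 - 2 cos (h t)) |trace v|^2]; at 0 the wave is constant
    and its mean is [h] times its trace. *)
Lemma lowest_band_principal (v : R -> 'cV[C]_k.+1) :
  (forall x, analytic_mx v x) -> (forall t, v t != 0) ->
  (forall t, exists q, bloch_pair E (phase t) (nth 0 (sig t) 0) (v t) q) ->
  principal (fun t => nth 0 (sig t) 0) v.
Proof.
move=> van v0 vP.
have s0 := band_0_0 phase0 sig_sorted sig_size sigP (ltn0Sn k).
have [c c0 vE] : exists2 c : C, c != 0 & v 0 = c *: e0 R k.
  have [q vq] := vP 0; have [_ [c [vE _]]] := bloch_kernel (phase_unit 0) vq s0.
  exists c => //; apply: contra (v0 0) => /eqP c0.
  by rewrite vE c0 scale0r.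
split=> //; first by exists c.
pose m t := ip E (e0 R k) (v t); pose g t := eval r (v t).
have man x : real_analytic_atC m x.
  have H : analytic_mx (fun t => (e0 R k)^t* *m M *m v t) x.
    by apply: analytic_mxM => //; exact: analytic_mx_cst.
  exact: H.
have gan x : real_analytic_atC g x.
  have H : analytic_mx (fun t => r^T *m v t) x.
    by apply: analytic_mxM => //; exact: analytic_mx_cst.
  exact: H.
have sE t : nth 0 (sig t) 0 * normsq (m t) = (2 - 2 * cos (- h * t)) * normsq (g t).
  have [q vq] := vP t; have := bloch_mean (phase_unit t) (v0 t) vq.
  rewrite !normsqE -!rmorphM => /complexI ->; congr (_ * _).
  rewrite /normsq /phase /expi /=; have := cos2Dsin2 (- h * t).
  move: (cos _) (sin _) => x y xy.
  have -> : (1 - x) ^+ 2 + (0 - y) ^+ 2 = 1 - 2 * x + (x ^+ 2 + y ^+ 2) by ring.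
  by rewrite xy; ring.
have c2 : normsq c != 0.
  apply: contra c0 => /eqP c2; rewrite -mul_conjC_eq0 normsqE c2; exact: eqxx.
have m0 : normsq (m 0) = (- h) ^+ 2 * normsq (g 0).
  rewrite /m /g vE ipZr mass_1_1 evalZ eval_r_e0 mulr1 normsqM.
  by rewrite /normsq /=; ring.
apply: (derive2_quotient (c := - h) _ (normsq_entire man) (normsq_entire gan) sE s0 _ m0).
  by move=> x; exact: sig_an.
rewrite m0 mulf_neq0//; first by rewrite expf_eq0 /= oppr_eq0 gt_eqF.
by rewrite /g vE evalZ eval_r_e0 mulr1.
Qed.

End Frame.

Theorem theorem3p1 (R : realType) (k : nat) (h : R) (Km K0 Kp : 'M[R]_k.+1) :
  0 < h -> stiffness_blocks h Km K0 Kp ->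
  exists (sigma : 'I_k.+1 -> R -> R) (v : 'I_k.+1 -> R -> 'cV[R[i]]_k.+1),
  [/\ (* real-analytic eigenpairs *)
      forall j xi, Pi_h h xi ->
        [/\ real_analytic_at (sigma j) xi,
            forall l, real_analytic_atC (fun t => v j t l 0) xi
          & gen_eigenpair (symbol_mx h Km K0 Kp xi) (massC h k)
                          (sigma j xi) (v j xi)],
      (* orthonormality *)
      forall xi, Pi_h h xi -> forall i j,
        (v i xi)^t* *m massC h k *m v j xi = ((i == j)%:R)%:M,
      (* (1) *)
      exists p : 'I_k.+1,
        unique (fun i => principal (sigma i) (v i)) p /\
        forall i, i != p -> 0 < sigma i 0
    & (* (2) *)
      forall i xi, Pi_h h xi -> sigma i xi = sigma i (- xi)].
Proof.
move=> h0 Kblocks; pose E := cell_element k h0.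
have [sig [ssort ssize sP san]] := bloch_bands E (phase_analytic h) (phase_unit h).
have /choice[v vP] := band_eigenvectors ssort ssize sP san.
have v0 i t : v i t != 0 by case: (vP i).
have vq (i : 'I_k.+1) t : exists q, bloch_pair E (phase h t) (nth 0 (sig t) i) (v i t) q.
  by have [_ _ _] := vP i; apply.
have pos t (i : 'I_k.+1) : i != 0 -> 0 < nth 0 (sig t) i.
  move=> i0; apply: (band_pos ssort ssize sP (ltn0Sn k)).
  by rewrite lt0n i0 ltn_ord.
exists (fun i t => nth 0 (sig t) i), v; split.
- move=> j xi _; split; first exact: san.
    by move=> a; have [van _ _ _] := vP j; exact: van.
  split=> //; have [q jq] := vq j xi.
  rewrite (symbol_mxE h0 _ Kblocks) mulmxBl -scalemxAl.
  have -> : expi (- (xi * h)) = phase h xi by rewrite /phase mulrC mulNr.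
  apply/eqP; rewrite subr_eq0; apply/eqP.
  by apply/bloch_mxP; exists q.
- move=> xi _ i j; rewrite [LHS]mx11_scalar; congr (_%:M).
  have [<-|ij] := eqVneq i j; first by have [_ vv _ _] := vP i; exact: vv.
  have [q iq] := vq i xi; have [p jp] := vq j xi.
  apply: (bloch_orthogonal (phase_unit h xi) iq jp).
  by rewrite nth_uniq ?ssize ?ltn_ord// lt_sorted_uniq.
- exists 0; split; last by move=> i i0; exact: pos.
  split.
    apply: (lowest_band_principal ssort ssize sP san) => [x|t|t] //.
      by have [van _ _ _] := vP 0; exact: van.
    exact: vq.
  move=> i [s0 _ _]; apply/eqP; rewrite eq_sym; apply/negPn/negP => i0.
  by have := pos 0 i i0; rewrite s0 ltxx.
- move=> i xi _.
  by rewrite (band_even ssort sP (phaseN h xi)).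
Qed.
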